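(* Let $K\ge 3$ and $v_0\in\{1,\dots,K\}$. Algorithm WF (given in the context) is a linearizable, wait-free, quiescent history-independent implementation of a single-writer single-reader (SWSR) $K$-valued register with initial value $v_0$ from binary registers.
   Context: **Model.** An abstract object is a tuple $(Q,q_0,O,R,\Delta)$: states, initial state, operations, responses, and a deterministic sequential specification $\Delta:Q\times O\to Q\times R$; all states are reachable from $q_0$. Asynchronous processes communicate through shared base objects $obj_1,\dots,obj_m$ with state spaces $Q_1,\dots,Q_m$. A (deterministic) implementation gives each process a program for each operation; after an invocation the process takes steps, each consisting of local computation and one atomic primitive operation on a base object, and may eventually return a response. Each process has at most one pending operation (invoked, not yet returned) at a time. A configuration gives the local state of each process and the state of each base object; the initial configuration is unique. An execution is an alternating sequence of configurations and steps from the initial configuration. For a finite execution $\alpha$, $\mathrm{mem}(\alpha)\in Q_1\times\dots\times Q_m$ is the vector of base-object states in its last configuration. $H(\alpha)$ is the sequence of invocations and responses of high-level operations in $\alpha$. **Linearizability.** A completion of $H(\alpha)$ appends responses to zero or more pending operations. A linearization of $\alpha$ is a sequential history that is a permutation of a completion of $H(\alpha)$ (pending operations without responses being dropped), matches the sequential specification, and respects the real-time order of non-overlapping operations. An implementation is linearizable if every execution has a linearization; a linearization function $h$ maps each execution $\alpha$ to a linearization $h(\alpha)$. For a sequential history $H$, $\mathrm{state}(H)$ is the state reached by applying its operations in order from $q_0$. **History independence.** An implementation is HI with respect to a set $E$ of finite executions if for some linearization function $h$, for all $\alpha,\alpha'\in E$ with $\mathrm{state}(h(\alpha))=\mathrm{state}(h(\alpha'))$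 we have $\mathrm{mem}(\alpha)=\mathrm{mem}(\alpha')$. A configuration is quiescent if no operation is pending in it. Quiescent HI means HI with respect to all finite executions ending in a quiescent configuration. **Wait-freedom.** Every pending operation by a process returns within a finite number of steps of that process. **Register.** A SWSR $K$-valued register has states $\{1,\dots,K\}$, $\mathrm{Write}(v)$ sets the state to $v$, $\mathrm{Read}()$ returns the state; only one process (the writer) invokes Write and only one other process (the reader) invokes Read. A binary register is an atomic read/write register with values in $\{0,1\}$. **Algorithm WF.** Shared binary registers $A[1..K]$, $B[1..K]$, $flag[1]$, $flag[2]$, initially all $0$ except $A[v_0]=1$. The writer has a persistent local variable $last$, initially $v_0$. - $\mathrm{TryRead}()$: for $j=1,\dots,K$: read $A[j]$; if it is $1$, set $val\leftarrow j$, then for $j'=j-1,\dots,1$ read $A[j']$ and if it is $1$ set $val\leftarrow j'$; then return $val$. If no $1$ is found in the upward scan, return $\bot$. - $\mathrm{Read}()$: (R1) $flag[1]\leftarrow 1$. (R2) At most twice: $val\leftarrow\mathrm{TryRead}()$, and if $val\ne\bot$ go to (R4). (R3) For $j=1,\dots,K$: if $B[j]=1$ then $val\leftarrow j$. (R4) $flag[2]\leftarrow 1$. (R5) For $j=1,\dots,K$: $B[j]\leftarrow 0$. (R6) $flag[1]\leftarrow 0$. (R7) $flag[2]\leftarrow 0$. (R8) Return $val$. - $\mathrm{Write}(v)$: (W1) Read $B[1],\dots,B[K]$; if some entry read is $1$, go to (W6). (W2) Read $flag[1]$; if it is $0$, go to (W6). (W3) $B[last]\leftarrow 1$. (W4)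 Read $flag[2]$ and then $flag[1]$; if $flag[2]=1$ or $flag[1]=0$ then (W5) $B[last]\leftarrow 0$. (W6) $A[v]\leftarrow 1$. (W7) For $j=v-1,\dots,1$: $A[j]\leftarrow 0$. (W8) For $j=v+1,\dots,K$: $A[j]\leftarrow 0$. (W9) $last\leftarrow v$; return. *)

(* Defs.v *)
From HB Require Import structures.
From mathcomp Require Import all_boot.

Set Implicit Arguments.
Unset Strict Implicit.
Unset Printing Implicit Defensive.
Set Warnings "-redundant-canonical-projection".

(** * Finite or infinite sequences *)

Inductive trace (T : Type) : Type :=
| Fin of seq T
| Inf of (nat -> T).

Definition tr_nth {T : Type} (s : trace T) (n : nat) : option T :=
  match s with Fin l => onth l n | Inf f => Some (f n) end.

Definition tr_take {T : Type} (n : nat) (s : trace T) : seq T :=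
  match s with Fin l => take n l | Inf f => mkseq f n end.

(** * Abstract objects *)

Record object : Type := Object {
  state : Type;
  init : state;
  op : Type;
  resp : Type;
  delta : state -> op -> state * resp;
  _ : forall q : state,
        exists os : seq op, foldl (fun q o => (delta q o).1) init os = q
}.

Inductive reg_op (T : Type) : Type :=
| Read
| Write of T.
Arguments Read {T}.
Arguments Write {T} _.

(* [None] is the (void) response of a write; a read of [q] responds [Some q]. *)
Definition reg_delta {T : Type} (q : T) (o : reg_op T) : T * option T :=
  match o with Read => (q, Some q) | Write v => (v, None) end.

Lemma reg_reachable (T : Type) (v0 q : T) :
  exists os : seq (reg_op T), foldl (fun q o => (reg_delta q o).1) v0 os = q.
Proof. by exists [:: Write q]. Qed.

Definition register (T : Type) (v0 : T) : object :=
  Object (@reg_reachable T v0).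

Definition binary_register (b0 : bool) : object := register b0.

(** * Implementations *)

(* The effect of the next step of a process whose operation is pending. *)
Inductive action (obj : object) (I : Type) (base : I -> object)
    (idle busy : Type) : Type :=
| Return of resp obj & idle
| Access (i : I) (o : op (base i)) of (resp (base i) -> busy).
Arguments Return {obj I base idle busy} _ _.
Arguments Access {obj I base idle busy} i o _.

(* [may p o] says that process [p] may invoke operation [o].  The local state
   of [p] lies in [idle p] (values of its persistent variables) when it has no
   pending operation, and in [busy p] when it has one. *)
Record implementation (obj : object) (P : finType) (may : P -> op obj -> bool)
    (I : finType) (base : I -> object) : Type := Implementation {
  idle : P -> Type;
  busy : P -> Type;
  linit : forall p : P, idle p;
  start : forall (p : P) (o : op obj), may p o -> idle p -> busy p;
  next : forall p : P, busy p -> action obj base (idle p) (busy p)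
}.

Section Model.

Context {obj : object} {P : finType} {may : P -> op obj -> bool}
        {I : finType} {base : I -> object}.
Variable imp : implementation may base.

(** ** Configurations and executions *)

Record config : Type := Config {
  loc : forall p : P, idle imp p + busy imp p;
  bmem : forall i : I, state (base i)
}.

Definition config0 : config :=
  Config (fun p => inl (linit imp p)) (fun i => init (base i)).

Inductive event : Type :=
| Invoke of P & op obj
| Prim of P
| Respond of P & resp obj.

Definition proc_of (e : event) : P :=
  match e with Invoke p _ => p | Prim p => p | Respond p _ => p end.

Inductive step (c : config) : event -> config -> Prop :=
| StepInvoke (p : P) (o : op obj) (po : may p o) (l : idle imp p) :
    loc c p = inl l ->
    step c (Invoke p o) (Config (dfwith (loc c) (inr (start po l))) (bmem c))
| StepPrim (p : P) (l : busy imp p) (i : I) (o : op (base i))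
    (k : resp (base i) -> busy imp p) :
    loc c p = inr l -> next l = Access i o k ->
    step c (Prim p)
      (Config (dfwith (loc c) (inr (k (delta (bmem c i) o).2)))
              (dfwith (bmem c) (delta (bmem c i) o).1))
| StepRespond (p : P) (l : busy imp p) (r : resp obj) (l' : idle imp p) :
    loc c p = inr l -> next l = Return r l' ->
    step c (Respond p r) (Config (dfwith (loc c) (inl l')) (bmem c)).

Definition last_config (s : seq (event * config)) : config :=
  last config0 (map snd s).

(* The [n]th entry of the trace is the [n]th step of the execution together
   with the configuration that it leads to. *)
Definition execution (a : trace (event * config)) : Prop :=
  forall (n : nat) (e : event) (c : config),
    tr_nth a n = Some (e, c) -> step (last_config (tr_take n a)) e c.

Definition quiescent (c : config) : Prop :=
  forall p : P, exists l : idle imp p, loc c p = inl l.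

(** ** Linearizability *)

Definition event_at (a : trace (event * config)) (n : nat) (e : event) : Prop :=
  omap fst (tr_nth a n) = Some e.

(* Operation instances are identified by the position of their invocation. *)
Definition invoked (a : trace (event * config)) (n : nat) (p : P)
    (o : op obj) : Prop :=
  event_at a n (Invoke p o).

Definition returns (a : trace (event * config)) (n m : nat)
    (r : resp obj) : Prop :=
  exists (p : P) (o : op obj),
    [/\ invoked a n p o, n < m, event_at a m (Respond p r) &
        forall (k : nat) (r' : resp obj),
          n < k < m -> ~ event_at a k (Respond p r')].

(* [c n] is the response, in the completed history, of the operation invoked at
   position [n], and [None] if that operation is dropped. *)
Definition completion (a : trace (event * config))
    (c : nat -> option (resp obj)) : Prop :=
  (forall n : nat, c n -> exists (p : P) (o : op obj), invoked a n p o) /\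
  (forall (n m : nat) (r : resp obj), returns a n m r -> c n = Some r).

(* An operation together with its response; a sequential history, in which each
   invocation is immediately followed by its response, is a [trace seq_op]. *)
Record seq_op : Type := SeqOp {
  sid : nat;
  sproc : P;
  sop : op obj;
  sresp : resp obj
}.

Definition state_of (s : seq seq_op) : state obj :=
  foldl (fun q x => (delta q (sop x)).1) (init obj) s.

Definition legal (s : trace seq_op) : Prop :=
  forall (n : nat) (x : seq_op), tr_nth s n = Some x ->
    sresp x = (delta (state_of (tr_take n s)) (sop x)).2.

Definition permutation_of (a : trace (event * config))
    (c : nat -> option (resp obj)) (s : trace seq_op) : Prop :=
  [/\ forall (n : nat) (x : seq_op), tr_nth s n = Some x ->
        invoked a (sid x) (sproc x) (sop x) /\ c (sid x) = Some (sresp x),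
      forall (n m : nat) (x y : seq_op),
        tr_nth s n = Some x -> tr_nth s m = Some y ->
        sid x = sid y -> n = m &
      forall i : nat, c i ->
        exists (n : nat) (x : seq_op), tr_nth s n = Some x /\ sid x = i].

Definition respects_real_time (a : trace (event * config))
    (s : trace seq_op) : Prop :=
  forall (n m : nat) (x y : seq_op) (j : nat) (r : resp obj),
    tr_nth s n = Some x -> tr_nth s m = Some y ->
    returns a (sid x) j r -> j < sid y -> n < m.

Definition linearization (a : trace (event * config))
    (s : trace seq_op) : Prop :=
  [/\ exists c : nat -> option (resp obj), completion a c /\ permutation_of a c s,
      legal s & respects_real_time a s].

Lemma linearization_finite (a : seq (event * config)) (f : nat -> seq_op) :
  ~ linearization (Fin a) (Inf f).
Proof.
move=> [[c [_ [inv inj _]]] _ _].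
have u : uniq [seq sid (f n) | n <- iota 0 (size a).+1].
  rewrite map_inj_in_uniq ?iota_uniq // => n m _ _ E.
  exact: (inj n m _ _ erefl erefl E).
have s : {subset [seq sid (f n) | n <- iota 0 (size a).+1] <= iota 0 (size a)}.
  move=> x /mapP[n _ ->]; rewrite mem_iota /= add0n.
  have [] := inv n _ erefl; rewrite /invoked /event_at /= => E _.
  by case: ltnP => // h; rewrite onthE nth_default ?size_map in E.
by have := uniq_leq_size u s; rewrite size_map !size_iota ltnn.
Qed.

Definition linearizable : Prop :=
  forall a : trace (event * config), execution a ->
    exists s : trace seq_op, linearization a s.

Definition linearization_function
    (h : trace (event * config) -> trace seq_op) : Prop :=
  forall a : trace (event * config), execution a -> linearization a (h a).

(** ** History independence *)

(* Quantifying over finite [s] and [s'] loses nothing, by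
   [linearization_finite]. *)
Definition history_independent (E : seq (event * config) -> Prop) : Prop :=
  exists2 h : trace (event * config) -> trace seq_op,
    linearization_function h &
    forall (a a' : seq (event * config)) (s s' : seq seq_op),
      execution (Fin a) -> execution (Fin a') -> E a -> E a' ->
      h (Fin a) = Fin s -> h (Fin a') = Fin s' ->
      state_of s = state_of s' ->
      forall i : I, bmem (last_config a) i = bmem (last_config a') i.

Definition quiescent_HI : Prop :=
  history_independent (fun a => quiescent (last_config a)).

(** ** Wait-freedom *)

(* No operation stays pending while its process takes infinitely many steps. *)
Definition wait_free : Prop :=
  forall a : nat -> event * config, execution (Inf a) ->
  forall (n : nat) (p : P) (o : op obj), invoked (Inf a) n p o ->
    (exists (m : nat) (r : resp obj), returns (Inf a) n m r) \/
    (exists N : nat, forall m : nat, N <= m -> proc_of (a m).1 <> p).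

End Model.

(** * Single-writer single-reader registers *)

Inductive role : Type := Writer | Reader.

Definition role_bool (p : role) : bool := if p is Writer then true else false.
Definition bool_role (b : bool) : role := if b then Writer else Reader.
Lemma role_boolK : cancel role_bool bool_role. Proof. by case. Qed.
HB.instance Definition _ : isCountable role := CanIsCountable role_boolK.
HB.instance Definition _ : isFinite role := CanIsFinite role_boolK.

Definition swsr {T : Type} (p : role) (o : reg_op T) : bool :=
  match p, o with
  | Writer, Write _ => true
  | Reader, Read => true
  | _, _ => false
  end.

(** * Algorithm WF *)

(* The values 1, ..., K and the indices of A and B are represented by 'I_K,
   with [j : 'I_K] standing for [j + 1]. *)

Inductive cell (K : nat) : Type :=
| A of 'I_K
| B of 'I_K
| Flag1
| Flag2.
Arguments A {K} _.
Arguments B {K} _.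
Arguments Flag1 {K}.
Arguments Flag2 {K}.

Definition cell_sum (K : nat) (x : cell K) : 'I_K + 'I_K + bool :=
  match x with
  | A j => inl (inl j) | B j => inl (inr j)
  | Flag1 => inr true | Flag2 => inr false
  end.
Definition sum_cell (K : nat) (x : 'I_K + 'I_K + bool) : cell K :=
  match x with
  | inl (inl j) => A j | inl (inr j) => B j
  | inr true => Flag1 | inr false => Flag2
  end.
Lemma cell_sumK (K : nat) : cancel (@cell_sum K) (@sum_cell K).
Proof. by case. Qed.
HB.instance Definition _ (K : nat) : isCountable (cell K) :=
  CanIsCountable (@cell_sumK K).
HB.instance Definition _ (K : nat) : isFinite (cell K) :=
  CanIsFinite (@cell_sumK K).

Definition cells (K : nat) (v0 : 'I_K) (x : cell K) : object :=
  binary_register (if x is A j then j == v0 else false).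

(* Programs over binary registers. *)
Inductive prog (K : nat) (X : Type) : Type :=
| Done of X
| ReadBit of cell K & (bool -> prog K X)
| WriteBit of cell K & bool & prog K X.
Arguments Done {K X} _.

Fixpoint bind {K : nat} {X Y : Type} (m : prog K X) (f : X -> prog K Y) :
    prog K Y :=
  match m with
  | Done x => f x
  | ReadBit c k => ReadBit c (fun b => bind (k b) f)
  | WriteBit c b m' => WriteBit c b (bind m' f)
  end.

Definition rd {K : nat} (c : cell K) : prog K bool := ReadBit c Done.
Definition wr {K : nat} (c : cell K) (b : bool) : prog K unit :=
  WriteBit c b (Done tt).

Declare Scope prog_scope.
Delimit Scope prog_scope with prog.
Notation "'let*' x := m 'in' k" := (bind m (fun x => k))
  (at level 200, x name, right associativity) : prog_scope.
Notation "m ;; k" := (bind m (fun _ => k))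
  (at level 60, right associativity) : prog_scope.
Local Open Scope prog_scope.

Fixpoint for_each {K : nat} {X : Type} (s : seq 'I_K) (x : X)
    (body : 'I_K -> X -> prog K X) : prog K X :=
  if s is j :: s' then let* x' := body j x in for_each s' x' body else Done x.

Definition below {K : nat} (v : 'I_K) : seq 'I_K :=
  rev [seq j : 'I_K <- enum 'I_K | j < v].
Definition above {K : nat} (v : 'I_K) : seq 'I_K :=
  [seq j : 'I_K <- enum 'I_K | v < j].

Fixpoint scan_up {K : nat} (s : seq 'I_K) : prog K (option 'I_K) :=
  if s is j :: s' then
    let* b := rd (A j) in
    if b then
      let* val := for_each (below j) j (fun j' val =>
        let* b' := rd (A j') in Done (if b' then j' else val)) in
      Done (Some val)
    else scan_up s'
  else Done None.

Definition try_read {K : nat} : prog K (option 'I_K) := scan_up (enum 'I_K).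

Definition set_all {K : nat} (s : seq 'I_K) (c : 'I_K -> cell K) (b : bool) :
    prog K unit :=
  for_each s tt (fun j _ => wr (c j) b).

(* The variable [val] is [None] as long as it is undefined; returning [None]
   would not be a legal response to a read. *)
Definition read_prog {K : nat} : prog K (option 'I_K) :=
  wr Flag1 true ;;
  let* val := try_read in
  let* val := if val is Some _ then Done val else try_read in
  let* val := if val is Some _ then Done val else
    for_each (enum 'I_K) None (fun j val =>
      let* b := rd (B j) in Done (if b then Some j else val)) in
  wr Flag2 true ;;
  set_all (enum 'I_K) B false ;;
  wr Flag1 false ;;
  wr Flag2 false ;;
  Done val.

Definition help_prog {K : nat} (last : 'I_K) : prog K unit :=
  wr (B last) true ;;
  let* f2 := rd Flag2 in
  let* f1 := rd Flag1 in
  if f2 || ~~ f1 then wr (B last) false else Done tt.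

(* Returns the new value of [last]. *)
Definition write_prog {K : nat} (v last : 'I_K) : prog K 'I_K :=
  let* found := for_each (enum 'I_K) false (fun j found =>
    let* b := rd (B j) in Done (found || b)) in
  (if found then Done tt else
     let* f1 := rd Flag1 in
     if f1 then help_prog last else Done tt) ;;
  wr (A v) true ;;
  set_all (below v) A false ;;
  set_all (above v) A false ;;
  Done v.

Definition wf_idle (K : nat) (p : role) : Type :=
  match p with Writer => 'I_K | Reader => unit end.

Definition wf_init (K : nat) (v0 : 'I_K) (p : role) : wf_idle K p :=
  match p with Writer => v0 | Reader => tt end.

(* The result of a program is the response and the new persistent state. *)
Definition wf_busy (K : nat) (p : role) : Type :=
  prog K (option 'I_K * wf_idle K p).

Definition wf_start (K : nat) (p : role) (o : reg_op 'I_K) :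
    swsr p o -> wf_idle K p -> wf_busy K p :=
  match p, o with
  | Writer, Write v => fun _ last =>
      let* last' := write_prog v last in Done (None, last')
  | Reader, Read => fun _ _ => let* val := read_prog in Done (val, tt)
  | Writer, Read | Reader, Write _ => fun no => match notF no with end
  end.

Definition wf_next (K : nat) (v0 : 'I_K) (p : role) (m : wf_busy K p) :
    action (register v0) (cells v0) (wf_idle K p) (wf_busy K p) :=
  match m with
  | Done (r, l) => @Return (register v0) _ (cells v0) _ _ r l
  | ReadBit c k => @Access _ _ (cells v0) _ _ c Read (fun r => k (r == Some true))
  | WriteBit c b m' => @Access _ _ (cells v0) _ _ c (Write b) (fun _ => m')
  end.

Definition WF (K : nat) (v0 : 'I_K) :
    @implementation (register v0) role swsr (cell K) (cells v0) :=
  @Implementation (register v0) role swsr (cell K) (cells v0)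
    (wf_idle K) (wf_busy K) (wf_init v0) (@wf_start K) (@wf_next K v0).

(* Main.v *)
Require Import Defs.
From mathcomp Require Import all_boot.
From Stdlib Require Import ClassicalEpsilon.

Set Implicit Arguments.
Unset Strict Implicit.
Unset Printing Implicit Defensive.

(** At any time A holds one value x, or, during W7-W8, the old value and the
    new one; take its least element m as the current value of the register.  A
    write takes effect at the step at which m moves to its argument.  Every read
    returns a value that m took during the read, and is linearized there:
    - If TryRead returns x, then at the time A[x] was read as 1 either m = x, or
      A also held some y < x.  If y was the older of the two values, then A[y]
      was later read as 0, so m became x in between; if y was the newer one, then
      A[y] was read as 0 earlier, so m was x just before A[y] was set.
    - If both TryReads fail, then W6 is executed in each of them.  The write that
      executes the second of these W6 was invoked while flag[1] = 1 and
      flag[2] = 0, so that it left exactly one entry b of B set; that entry was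
      committed (at W4) during the read, while m = b, and it is not changed until
      R5.
    An entry of B that is not withdrawn at W5 was set before R4 of the read in
    progress at W4, so R5 clears it.  Hence in a quiescent configuration B and
    the flags are 0, and A holds the last value written only. *)

(** * Program counters and simulation *)

Section ProgramCounters.

Context (K : nat).
Implicit Types (i j l v o : 'I_K) (s : seq 'I_K).

(* The argument of the write is written [v], and the value of [last] is [l] or
   [o].  A scan is about to read entry [j] and then those of [s]. *)
Inductive wpc : Type :=
| WIdle (l : 'I_K)
| WScan (v l j : 'I_K) (s : seq 'I_K) (found : bool)
| WFlag (v l : 'I_K)
| WSet (v l : 'I_K)
| WChk2 (v l : 'I_K)
| WChk1 (v l : 'I_K) (f2 : bool)
| WUnset (v l : 'I_K)
| WAdd (v l : 'I_K)
| WClr (o v : 'I_K) (s : seq 'I_K).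

(* [again] tells the second TryRead from the first. *)
Inductive rpc : Type :=
| RIdle
| RStart
| RUp (again : bool) (j : 'I_K) (s : seq 'I_K)
| RDown (again : bool) (j : 'I_K) (s : seq 'I_K) (val : 'I_K)
| RScan (j : 'I_K) (s : seq 'I_K) (val : option 'I_K)
| RFlag2 (val : option 'I_K)
| RClr (j : 'I_K) (s : seq 'I_K) (val : option 'I_K)
| RUnflag1 (val : option 'I_K)
| RUnflag2 (val : option 'I_K)
| RDone (val : option 'I_K).

(** An exhausted loop takes no step, so the counter must already be that of the code that follows
    it; this and the next functions perform that normalization. *)
Definition wscan v l s f : wpc :=
  if s is j :: s' then WScan v l j s' f else if f then WAdd v l else WFlag v l.

Definition rscan s val : rpc :=
  if s is j :: s' then RScan j s' val else RFlag2 val.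
Definition rup2 s : rpc :=
  if s is j :: s' then RUp true j s' else rscan (enum 'I_K) None.
Definition rup (again : bool) s : rpc :=
  if again then rup2 s else
  if s is j :: s' then RUp false j s' else rup2 (enum 'I_K).
Definition rdown again s val : rpc :=
  if s is j :: s' then RDown again j s' val else RFlag2 (Some val).
Definition rclr s val : rpc :=
  if s is j :: s' then RClr j s' val else RUnflag1 val.

Local Open Scope prog_scope.

Let wtail v : prog K 'I_K :=
  wr (A v) true ;; set_all (below v) A false ;; set_all (above v) A false ;;
  Done v.

Let wret (m : prog K 'I_K) : 'I_K + wf_busy K Writer :=
  inr (let* l := m in Done (None, l)).

Definition wloc (w : wpc) : wf_idle K Writer + wf_busy K Writer :=
  match w with
  | WIdle l => inl l
  | WScan v l j s f => wret (
      let* found := for_each (j :: s) f (fun j found =>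
        let* b := rd (B j) in Done (found || b)) in
      (if found then Done tt else
        let* f1 := rd Flag1 in if f1 then help_prog l else Done tt) ;;
      wtail v)
  | WFlag v l => wret (
      (let* f1 := rd Flag1 in if f1 then help_prog l else Done tt) ;; wtail v)
  | WSet v l => wret (help_prog l ;; wtail v)
  | WChk2 v l => wret (
      (let* f2 := rd Flag2 in let* f1 := rd Flag1 in
       if f2 || ~~ f1 then wr (B l) false else Done tt) ;; wtail v)
  | WChk1 v l f2 => wret (
      (let* f1 := rd Flag1 in
       if f2 || ~~ f1 then wr (B l) false else Done tt) ;; wtail v)
  | WUnset v l => wret (wr (B l) false ;; wtail v)
  | WAdd v l => wret (wtail v)
  | WClr o v s => wret (set_all s A false ;; Done v)
  end.

Let rret (m : prog K (option 'I_K)) : wf_idle K Reader + wf_busy K Reader :=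
  inr (let* val := m in Done (val, tt)).

Let rclear s (val : option 'I_K) : prog K (option 'I_K) :=
  set_all s B false ;; wr Flag1 false ;; wr Flag2 false ;; Done val.
Let rtail (val : option 'I_K) : prog K (option 'I_K) :=
  wr Flag2 true ;; rclear (enum 'I_K) val.
Let rhelp (val : option 'I_K) : prog K (option 'I_K) :=
  let* val := if val is Some _ then Done val else
    for_each (enum 'I_K) None (fun j val =>
      let* b := rd (B j) in Done (if b then Some j else val)) in
  rtail val.
Let rtry (again : bool) (m : prog K (option 'I_K)) : prog K (option 'I_K) :=
  if again then let* val := m in rhelp val else
  let* val := m in
  let* val := if val is Some _ then Done val else try_read in
  rhelp val.

Definition rloc (r : rpc) : wf_idle K Reader + wf_busy K Reader :=
  match r with
  | RIdle => inl tt
  | RStart => rret read_prog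
  | RUp again j s => rret (rtry again (scan_up (j :: s)))
  | RDown again j s val => rret (rtry again (
      let* val := for_each (j :: s) val (fun j' val =>
        let* b' := rd (A j') in Done (if b' then j' else val)) in
      Done (Some val)))
  | RScan j s val => rret (
      let* val := for_each (j :: s) val (fun j val =>
        let* b := rd (B j) in Done (if b then Some j else val)) in
      rtail val)
  | RFlag2 val => rret (rtail val)
  | RClr j s val => rret (rclear (j :: s) val)
  | RUnflag1 val => rret (wr Flag1 false ;; wr Flag2 false ;; Done val)
  | RUnflag2 val => rret (wr Flag2 false ;; Done val)
  | RDone val => rret (Done val)
  end.

Lemma wloc_scan v l s f :
  wloc (wscan v l s f) = wret (
      let* found := for_each s f (fun j found =>
        let* b := rd (B j) in Done (found || b)) in
      (if found then Done tt else
        let* f1 := rd Flag1 in if f1 then help_prog l else Done tt) ;;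
      wtail v).
Proof. by case: s => //; case: f. Qed.

(** Fuses W7 and W8 into one loop, so that the single counter [WClr] covers both. *)
Lemma set_all_cat (X : Type) s1 s2 (c : 'I_K -> cell K) b (k : prog K X) :
  (set_all s1 c b ;; set_all s2 c b ;; k) = (set_all (s1 ++ s2) c b ;; k).
Proof. by elim: s1 => //= j s1 IH; congr WriteBit. Qed.

Lemma rloc_scan s val :
  rloc (rscan s val) = rret (
      let* val := for_each s val (fun j val =>
        let* b := rd (B j) in Done (if b then Some j else val)) in
      rtail val).
Proof. by case: s. Qed.

Lemma rloc_up again s : rloc (rup again s) = rret (rtry again (scan_up s)).
Proof.
have E s' : rloc (rup2 s') = rret (rtry true (scan_up s')).
  by case: s' => //; rewrite rloc_scan.
case: again => //=; case: s => //; exact: E.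
Qed.

Lemma rloc_down again s val :
  rloc (rdown again s val) = rret (rtry again (
      let* val := for_each s val (fun j' val =>
        let* b' := rd (A j') in Done (if b' then j' else val)) in
      Done (Some val))).
Proof. by case: s => //; case: again. Qed.

Lemma rloc_clr s val : rloc (rclr s val) = rret (rclear s val).
Proof. by case: s. Qed.

(* The contents of A and of the flags are determined by the two program
   counters; only B has to be tracked. *)
Definition Aof (w : wpc) (i : 'I_K) : bool :=
  match w with
  | WIdle l | WScan _ l _ _ _ | WFlag _ l | WSet _ l | WChk2 _ l
  | WChk1 _ l _ | WUnset _ l | WAdd _ l => i == l
  | WClr o v s => (i == v) || (i == o) && (o \in s)
  end.

Definition flag1 (r : rpc) : bool :=
  match r with RIdle | RStart | RUnflag2 _ | RDone _ => false | _ => true end.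
Definition flag2 (r : rpc) : bool :=
  match r with RClr _ _ _ | RUnflag1 _ | RUnflag2 _ => true | _ => false end.

(* [bm] is the contents of B, [adds] the number of executions of W6 since R1, and
   [seen] the list of the values of the register since the read was invoked. *)
Record astate : Type := AState {
  wp : wpc;
  rp : rpc;
  bm : 'I_K -> bool;
  adds : nat;
  seen : seq 'I_K
}.

Definition wprim (r : rpc) (b : 'I_K -> bool) (w : wpc) :
    option (wpc * ('I_K -> bool)) :=
  match w with
  | WScan v l j s f => Some (wscan v l s (f || b j), b)
  | WFlag v l => Some (if flag1 r then WSet v l else WAdd v l, b)
  | WSet v l => Some (WChk2 v l, fun i => (i == l) || b i)
  | WChk2 v l => Some (WChk1 v l (flag2 r), b)
  | WChk1 v l f2 =>
      Some (if f2 || ~~ flag1 r then WUnset v l else WAdd v l, b)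
  | WUnset v l => Some (WAdd v l, fun i => (i != l) && b i)
  | WAdd v l => Some (WClr l v (below v ++ above v), b)
  | WClr o v (j :: s) => Some (WClr o v s, b)
  | WIdle _ | WClr _ _ [::] => None
  end.

Definition rprim (w : wpc) (b : 'I_K -> bool) (r : rpc) :
    option (rpc * ('I_K -> bool)) :=
  match r with
  | RStart => Some (rup false (enum 'I_K), b)
  | RUp again j s =>
      Some (if Aof w j then rdown again (below j) j else rup again s, b)
  | RDown again j s val =>
      Some (rdown again s (if Aof w j then j else val), b)
  | RScan j s val => Some (rscan s (if b j then Some j else val), b)
  | RFlag2 val => Some (rclr (enum 'I_K) val, b)
  | RClr j s val => Some (rclr s val, fun i => (i != j) && b i)
  | RUnflag1 val => Some (RUnflag2 val, b)
  | RUnflag2 val => Some (RDone val, b)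
  | RIdle | RDone _ => None
  end.

(* The abstract value of the register: the least index set in A. *)
Definition value (w : wpc) : 'I_K :=
  match w with
  | WIdle l | WScan _ l _ _ _ | WFlag _ l | WSet _ l | WChk2 _ l
  | WChk1 _ l _ | WUnset _ l | WAdd _ l => l
  | WClr o v s => if (o < v) && (o \in s) then o else v
  end.

End ProgramCounters.
Arguments RIdle {K}.
Arguments RStart {K}.

(** * The simulation relation between configurations and program counters *)

Section Simulation.

Context (K : nat) (v0 : 'I_K).

Local Notation event := (@event (register v0) role).
Local Notation config := (config (WF v0)).
Local Notation astate := (astate K).

Definition core_step (x : astate) (e : event) :
    option (wpc K * rpc K * ('I_K -> bool)) :=
  match e with
  | Invoke Writer (Write v) =>
      if wp x is WIdle l then Some (wscan v l (enum 'I_K) false, rp x, bm x)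
      else None
  | Invoke Reader Read =>
      if rp x is RIdle then Some (wp x, RStart, bm x) else None
  | Prim Writer =>
      if wprim (rp x) (bm x) (wp x) is Some (w, b) then Some (w, rp x, b)
      else None
  | Prim Reader =>
      if rprim (wp x) (bm x) (rp x) is Some (r, b) then Some (wp x, r, b)
      else None
  | Respond Writer None =>
      if wp x is WClr o v [::] then Some (WIdle v, rp x, bm x) else None
  | Respond Reader v =>
      if rp x is RDone v' then
        if v == v' then Some (wp x, RIdle, bm x) else None
      else None
  | _ => None
  end.

(** [adds] and [seen] are ghost variables. Resetting [adds] as long as the reader is at [RStart]
    makes it count from R1 on. *)
Definition astep (x : astate) (e : event) : option astate :=
  if core_step x e is Some (w, r, b) then
    Some (AState w r b
      (if r is RStart then 0 else
        adds x + (if e is Prim Writer then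
                    if wp x is WAdd _ _ then 1 else 0 else 0))
      (value w :: (if e is Invoke Reader _ then [::] else seen x)))
  else None.

Definition represents (c : config) (x : astate) : Prop :=
  [/\ loc c Writer = wloc (wp x), loc c Reader = rloc (rp x)
    & forall i : cell K, bmem c i =
      match i with
      | A j => Aof (wp x) j | B j => bm x j
      | Flag1 => flag1 (rp x) | Flag2 => flag2 (rp x)
      end].

(** Clearing an entry thus removes it from the list for good and never touches [v], which makes
    [Aof] exact during W7 and W8. *)
Definition wclr_ok (w : wpc K) : bool :=
  if w is WClr o v s then uniq s && (v \notin s) else true.

Definition astart : astate :=
  AState (WIdle v0) RIdle (fun _ => false) 0 [:: v0].

Lemma represents0 : represents (config0 (WF v0)) astart.
Proof. by split=> //; case. Qed.

Definition set_loc (c : config) (p : role)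
    (l : wf_idle K p + wf_busy K p) : forall q, wf_idle K q + wf_busy K q :=
  dfwith (loc c) (l : idle (WF v0) p + busy (WF v0) p).

Local Notation Config := (@Config _ _ _ _ _ (WF v0)).

Definition access_result (c : config) (p : role)
    (act : action (register v0) (cells v0) (wf_idle K p) (wf_busy K p)) :
    option config :=
  match act with
  | Access i o k => Some (Config
      (set_loc c (inr (k (delta (bmem c i) o).2)))
      (dfwith (bmem c) (delta (bmem c i) o).1))
  | Return _ _ => None
  end.

(** Inversion in equational form: [access_result] hides the dependent arguments of [Access], so that
    case analysis on the remaining program computes the successor. *)
Lemma stepE (c : config) (e : event) (c' : config) : step c e c' ->
  match e with
  | Invoke p o => exists (po : swsr p o) (l : wf_idle K p),
      loc c p = inl l /\
      c' = Config (set_loc c (inr (@wf_start K p o po l))) (bmem c)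
  | Prim p => exists l : wf_busy K p,
      loc c p = inr l /\ access_result c (wf_next v0 l) = Some c'
  | Respond p r => exists (l : wf_busy K p) (l' : wf_idle K p),
      [/\ loc c p = inr l, wf_next v0 l = @Return (register v0) _ _ _ _ r l' &
      c' = Config (set_loc c (inl l' : wf_idle K p + wf_busy K p)) (bmem c)]
  end.
Proof.
case=> [p o po l El|p l i o k El En|p l r l' El En].
- by exists po, l.
- by exists l; split=> //; rewrite /= in En; rewrite En.
- by exists l, l'.
Qed.

Lemma mem_below (v i : 'I_K) : (i \in below v) = (i < v).
Proof. by rewrite mem_rev mem_filter mem_enum andbT. Qed.

Lemma mem_above (v i : 'I_K) : (i \in above v) = (v < i).
Proof. by rewrite mem_filter mem_enum andbT. Qed.

Lemma dfwith_mem (m : forall i : cell K, state (cells v0 i)) (i : cell K)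
    (b : bool) (i' : cell K) :
  dfwith m (b : state (cells v0 i)) i' = (if i' == i then b else m i') :> bool.
Proof.
by case: eqP => [->|/eqP ne]; rewrite /set_loc ?dfwith_in ?dfwith_out // eq_sym.
Qed.

Lemma cell_eqE (i j : cell K) : (i == j) =
  match i, j with
  | A i, A j => i == j
  | B i, B j => i == j
  | Flag1, Flag1 | Flag2, Flag2 => true
  | _, _ => false
  end.
Proof.
by case: i j => [i|i||] [j|j||]; apply/eqP => //; case: eqP => [->|] // ne [].
Qed.

(** [represents] does not look at the ghost variables, so [0] and [[::]] are dummies. *)
Lemma simulation_writer c c' x :
  step c (Prim Writer) c' -> represents c x -> wclr_ok (wp x) ->
  exists w b, wprim (rp x) (bm x) (wp x) = Some (w, b) /\
    represents c' (AState w (rp x) b 0 [::]).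
Proof.
case: x => w r b n S /stepE[p [El Ec]] [Rw Rr Rm] ok.
rewrite /= in Rw Rr Rm ok *; rewrite El in Rw.
have R' w' b' l' (m : forall i : cell K, state (cells v0 i)) :
    l' = wloc w' ->
    (forall i : cell K, m i =
      match i with
      | A j => Aof w' j | B j => b' j | Flag1 => flag1 r | Flag2 => flag2 r
      end) ->
    represents (Config (set_loc c (l' : wf_idle K Writer + wf_busy K Writer))
      m)
      (AState w' r b' 0 [::]).
  by move=> -> Em; split=> //=; rewrite /set_loc ?dfwith_in ?dfwith_out.
(* For reading steps, which overwrite a cell with the value it already has. *)
have R1 w' l' (i : cell K) (v : bool) : l' = wloc w' -> Aof w' =1 Aof w ->
    v = bmem c i ->
    represents (Config (set_loc c (l' : wf_idle K Writer + wf_busy K Writer))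
      (dfwith (bmem c) (v : state (cells v0 i))))
      (AState w' r b 0 [::]).
  move=> E1 E2 ->; apply: R' => // k; rewrite dfwith_mem.
  by case: eqP => [->|_]; rewrite Rm; [case: i|case: k] => // ?; rewrite E2.
case: w Rw Rm ok R1 => //= [v l j s f|v l|v l|v l|v l f2|v l|v l|o v [|j s]] [Ep] Rm ok R1;
  move: Ec; rewrite Ep => //= -[<-].
- exists (wscan v l s (f || b j)), b; split=> //; apply: R1 => //.
    by rewrite wloc_scan Rm; case: (b j).
  by move=> i; case: (s) => //; case: (f || b j).
- exists (if flag1 r then WSet v l else WAdd v l), b; split=> //; apply: R1 => //.
    by rewrite Rm; case: (flag1 r).
  by move=> i; case: (flag1 r).
- exists (WChk2 v l), (fun i => (i == l) || b i); split=> //; apply: R' => // i.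
  rewrite dfwith_mem Rm cell_eqE; case: i => //.
- exists (WChk1 v l (flag2 r)), b; split=> //; apply: R1 => //.
    by rewrite Rm; case: (flag2 r).
- exists (if f2 || ~~ flag1 r then WUnset v l else WAdd v l), b; split=> //; apply: R1 => //.
    by rewrite Rm; case: (flag1 r); case: (f2).
  by move=> i; case: ifP.
- exists (WAdd v l), (fun i => (i != l) && b i); split=> //; apply: R' => // i.
  by rewrite dfwith_mem Rm cell_eqE; case: i => // i; case: eqP.
- exists (WClr l v (below v ++ above v)), b; split=> //; apply: R'.
    by rewrite /= -set_all_cat.
  move=> i; rewrite dfwith_mem Rm cell_eqE; case: i => // i /=.
  (* The list contains every index but [v], so [l] counts as still set exactly if it differs from
     [v]. *)
  rewrite mem_cat mem_below mem_above; case: eqP => //= ne.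
  case: eqP => //= e; rewrite e in ne.
  by case: ltngtP => // /val_inj /ne.
- exists (WClr o v s), b; split=> //; apply: R' => //.
  move=> i; rewrite dfwith_mem Rm cell_eqE; case: i => // i /=.
  move: ok; rewrite !inE negb_or => /andP[/andP[js us] /andP[vj vs]].
  case: eqP => [->|ne].
    rewrite eq_sym (negPf vj) /=; case: eqP => // <-; by rewrite (negPf js).
  by case: (i =P o) => [e|]; rewrite ?inE -?e ?(introF eqP ne).
Qed.

Lemma simulation_reader c c' x :
  step c (Prim Reader) c' -> represents c x ->
  exists r b, rprim (wp x) (bm x) (rp x) = Some (r, b) /\
    represents c' (AState (wp x) r b 0 [::]).
Proof.
case: x => w r b n S /stepE[p [El Ec]] [Rw Rr Rm].
rewrite /= in Rw Rr Rm *; rewrite El in Rr.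
have R' r' b' l' (m : forall i : cell K, state (cells v0 i)) :
    l' = rloc r' ->
    (forall i : cell K, m i =
      match i with
      | A j => Aof w j | B j => b' j | Flag1 => flag1 r' | Flag2 => flag2 r'
      end) ->
    represents (Config (set_loc c (l' : wf_idle K Reader + wf_busy K Reader))
      m)
      (AState w r' b' 0 [::]).
  by move=> -> Em; split=> //=; rewrite /set_loc ?dfwith_in ?dfwith_out.
have R1 r' l' (i : cell K) (v : bool) : l' = rloc r' ->
    flag1 r' = flag1 r -> flag2 r' = flag2 r -> v = bmem c i ->
    represents (Config (set_loc c (l' : wf_idle K Reader + wf_busy K Reader))
      (dfwith (bmem c) (v : state (cells v0 i))))
      (AState w r' b 0 [::]).
  move=> E1 E2 E3 ->; apply: R' => // k; rewrite dfwith_mem.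
  by case: eqP => [->|_]; rewrite Rm; [case: i|case: k] => // *; rewrite ?E2 ?E3.
have f1s s val : flag1 (rscan s val) = true by case: s.
have f2s s val : flag2 (rscan s val) = false by case: s.
have f1u a s : flag1 (rup a s) = true.
  by case: a; case: s => //=; case: (enum _) => //= *; rewrite f1s.
have f2u a s : flag2 (rup a s) = false.
  by case: a; case: s => //=; case: (enum _) => //= *; rewrite f2s.
have f1d a s val : flag1 (rdown a s val) = true by case: s.
have f2d a s val : flag2 (rdown a s val) = false by case: s.
have f1c s val : flag1 (rclr s val) = true by case: s.
have f2c s val : flag2 (rclr s val) = true by case: s.
case: r Rr Rm R1 => //= [|a j s|a j s val|j s val|val|j s val|val|val|val] [Ep] Rm R1;
  move: Ec; rewrite Ep => //=; rewrite ?Ep.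
- case=> <-; exists (rup false (enum 'I_K)), b; split=> //; apply: R'.
    by rewrite rloc_up.
  move=> i; rewrite dfwith_mem Rm cell_eqE f1u f2u.
  by case: i.
- move=> H; exists (if Aof w j then rdown a (below j) j else rup a s), b.
  split=> //; case: a {Ep} H => -[<-]; apply: R1 => //.
  1, 4: by rewrite Rm; case: (Aof w j); rewrite ?rloc_down ?rloc_up.
  1-4: by case: ifP; rewrite ?(f1u, f1d, f2u, f2d).
- move=> H; exists (rdown a s (if Aof w j then j else val)), b.
  split=> //; case: a {Ep} H => -[<-]; apply: R1; rewrite ?f1d ?f2d //.
  1, 2: by rewrite rloc_down Rm; case: (Aof w j).
- case=> <-; exists (rscan s (if b j then Some j else val)), b.
  split=> //; apply: R1; rewrite ?f1s ?f2s //.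
  by rewrite rloc_scan Rm; case: (b j).
- case=> <-; exists (rclr (enum 'I_K) val), b; split=> //; apply: R'.
    by rewrite rloc_clr.
  by move=> i; rewrite dfwith_mem Rm cell_eqE f1c f2c; case: i.
- case=> <-; exists (rclr s val), (fun i => (i != j) && b i); split=> //.
  apply: R'; first by rewrite rloc_clr.
  move=> i; rewrite dfwith_mem Rm cell_eqE f1c f2c; case: i => // i.
  by case: eqP.
- case=> <-; exists (RUnflag2 val), b; split=> //; apply: R' => // i.
  by rewrite dfwith_mem Rm cell_eqE; case: i.
- case=> <-; exists (RDone val), b; split=> //; apply: R' => // i.
  by rewrite dfwith_mem Rm cell_eqE; case: i.
Qed.

Lemma simulation c e c' x :
  step c e c' -> represents c x -> wclr_ok (wp x) ->
  exists2 x', astep x e = Some x' & represents c' x'.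
Proof.
move=> st Rx ok; rewrite /astep.
suff [w' [r' [b' [-> [Ew Er Em]]]]] : exists w' r' b',
    core_step x e = Some (w', r', b') /\
    represents c' (AState w' r' b' 0 [::]).
  by eexists; split.
case: e st => [p o|p|p res] st; last 1 first.
- move/stepE: st => [l [l' [El En ->]]].
  case: x Rx {ok} => w r b n S [/= Rw Rr Rm].
  case: p res l l' El En => res l l' El En.
  + rewrite El in Rw.
    case: w Rw Rm => //= [????? [e]|?? [e]|?? [e]|?? [e]|??? [e]|?? [e]|?? [e]
      |o v [|??] [e]] Rm; move: En; rewrite e //= => -[<- <-].
    exists (WIdle v), r, b; split=> //; split=> //=; rewrite /set_loc ?dfwith_in ?dfwith_out //.
    by move=> i; rewrite Rm; case: i => // i; rewrite in_nil andbF orbF.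
  + rewrite El in Rr.
    case: r Rr Rm => //= [[e]|[|] ?? [e]|[|] ??? [e]|??? [e]|? [e]|??? [e]
      |? [e]|? [e]|val [e]] Rm; move: En; rewrite e //= => -[<- <-].
    exists w, RIdle, b; rewrite eqxx; split=> //; split=> //=; rewrite /set_loc ?dfwith_in ?dfwith_out //.
- move/stepE: st; case: x Rx {ok} => w r b n S [/= Rw Rr Rm].
  case: p => [] [po [l [El ->]]] /=.
  + case: o po => // v po; rewrite El in Rw.
    case: w Rw Rm => //= l0 [->] Rm.
    exists (wscan v l0 (enum 'I_K) false), r, b; split=> //; split=> /=.
    * by rewrite /set_loc dfwith_in wloc_scan.
    * by rewrite /set_loc dfwith_out.
    * by move=> i; rewrite Rm; case: i => // j; case: (enum _).
  + case: o po => // po; rewrite El in Rr.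
    case: r Rr Rm => //= Er Rm.
    exists w, RStart, b; split=> //; split=> /=.
    * by rewrite /set_loc dfwith_out.
    * by rewrite /set_loc dfwith_in.
    * by move=> i; rewrite Rm.
- case: p st => st /=.
  + by have [w' [b' [-> H]]] := simulation_writer st Rx ok; exists w', (rp x), b'.
  + by have [r' [b' [-> H]]] := simulation_reader st Rx; exists (wp x), r', b'.
Qed.

End Simulation.

(** * Invariants *)

Section Invariant.

Context (K : nat).
Implicit Types (i j l v o : 'I_K) (s S : seq 'I_K) (w : wpc K) (r : rpc K).
Implicit Types (b : 'I_K -> bool).

(* The entry of B that is set may still be withdrawn by the writer. *)
Definition tentative w : bool :=
  match w with WChk2 _ _ | WChk1 _ _ _ | WUnset _ _ => true | _ => false end.

(* The same, for a writer that will see flag[2] = 1. *)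
Definition doomed w : bool :=
  match w with
  | WChk2 _ _ | WChk1 _ _ true | WUnset _ _ => true
  | _ => false
  end.

(** The value of the latest W6: its entry in A is 1 and it moves only at W6. So an upward scan that
    still has it ahead can fail only if a W6 takes place in the meantime. *)
Definition newest w : 'I_K := if w is WClr _ v _ then v else value w.

(* If A holds a greater, stale value besides the current value and the latter
   was passed over by the present scan, then the stale value was the value of
   the register at some time during the read. *)
Definition stale_seen w S (passed : pred 'I_K) : Prop :=
  if w is WClr o v s then v < o -> o \in s -> passed v -> o \in S else True.

(** Only the writer sets entries of B, so one that it has read as 0 stays 0. Hence B is empty after
    a W1 that finds no 1, and up to W5 it holds at most [last]. *)
Definition writer_inv w b : Prop :=
  match w with
  | WScan _ _ j s f => ~~ f -> forall i, b i -> i \in j :: s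
  | WFlag _ _ | WSet _ _ => forall i, ~~ b i
  | WChk2 _ l | WChk1 _ l _ | WUnset _ l => forall i, b i -> i = l
  | _ => True
  end.

(* What holds of a write invoked while flag[1] = 1 and flag[2] = 0. *)
Definition helped w b : Prop :=
  match w with
  | WScan _ _ _ _ f => f -> exists i, b i
  | WChk2 _ l => b l
  | WChk1 _ l f2 => b l /\ ~~ f2
  | WUnset _ _ => False
  | WAdd _ _ => exists i, b i
  | _ => True
  end.

(** For the time between R1 and R4, when flag[1] = 1 and flag[2] = 0. After one W6 in it, a write
    that has not reached W6 was invoked in it and so is [helped]; after a second W6, an entry of B
    is set and stays set until R5. *)
Definition reading w b n S : Prop :=
  [/\ forall i, b i -> tentative w \/ i \in S,
      0 < n -> helped w b
    & 1 < n -> ~~ tentative w /\ exists i, b i].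

(** [again], read as a number, counts the failed TryReads, each of which contains a W6. The second
    alternative in [RDown] is that A holds two values of which [val] is the newer: the older and
    smaller [y] is still set and still ahead of the scan. During R5 an entry of B is either yet to
    be cleared or bound to be withdrawn by the writer. *)
Definition reader_inv r w b n S : Prop :=
  match r with
  | RIdle => forall i, b i -> tentative w
  | RStart => n = 0 /\ forall i, b i -> tentative w
  | RUp again j s =>
      [/\ reading w b n S, path [rel i i' : 'I_K | i < i'] j s,
          stale_seen w S [predC j :: s], again <= n
        & again < n \/ newest w \in j :: s]
  | RDown again j s val =>
      [/\ reading w b n S, (forall i, i \in j :: s -> i < val),
          path [rel i i' : 'I_K | i' < i] j s /\ forall i, i < j -> i \in s,
          stale_seen w S [pred i : 'I_K | i < val]
        & val \in S \/ exists y s', [/\ w = WClr y val s', y \in s', y < val & y \in j :: s]]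
  | RScan j s val =>
      [/\ reading w b n S, 1 < n
        & forall i, b i -> i \notin j :: s -> val = Some i ] /\ forall i, val = Some i -> b i
  | RFlag2 val =>
      reading w b n S /\ exists2 i, val = Some i & i \in S
  | RClr j s val =>
      (forall i, b i -> (i \in j :: s) || doomed w) /\
      exists2 i, val = Some i & i \in S
  | RUnflag1 val | RUnflag2 val =>
      (forall i, b i -> doomed w) /\ exists2 i, val = Some i & i \in S
  | RDone val =>
      (forall i, b i -> tentative w) /\ exists2 i, val = Some i & i \in S
  end.

Definition wf_inv (x : astate K) : Prop :=
  [/\ wclr_ok (wp x), writer_inv (wp x) (bm x),
      forall i i', bm x i -> bm x i' -> i = i',
      value (wp x) \in seen x
    & reader_inv (rp x) (wp x) (bm x) (adds x) (seen x)].

(** * Steps of the writer, invocation and return included *)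

Inductive wstep r b w : wpc K -> ('I_K -> bool) -> Prop :=
| wstep_start v l : w = WIdle l -> wstep r b w (wscan v l (enum 'I_K) false) b
| wstep_prim w' b' : wprim r b w = Some (w', b') -> wstep r b w w' b'
| wstep_return o v : w = WClr o v [::] -> wstep r b w (WIdle v) b.

Definition added w : nat := if w is WAdd _ _ then 1 else 0.

Lemma wstep_wclr_ok r b w w' b' : wstep r b w w' b' -> wclr_ok w -> wclr_ok w'.
Proof.
case=> // [v l _ _|].
  by case: (enum _).
case: w => //= [v l j s f|v l|v l|v l|v l f2|v l|v l|o v [|j s]] // {}w' {}b' [<- _] //.
- by case: s; case: (f || b j).
- by case: ifP.
- by case: ifP.
- move=> _; apply/andP; split; last by rewrite mem_cat mem_below mem_above ltnn.
  have u (p : pred 'I_K) : uniq (filter p (enum 'I_K)).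
    exact/filter_uniq/enum_uniq.
  rewrite cat_uniq rev_uniq !u andbT /=.
  by apply/hasPn=> i; rewrite mem_above mem_below -leqNgt; exact: ltnW.
- by rewrite /= negb_or => /andP[/andP[_ ->] /andP[_ ->]].
Qed.

Lemma wstep_writer_inv r b w w' b' : wstep r b w w' b' ->
  (forall i i', b i -> b i' -> i = i') -> writer_inv w b ->
  writer_inv w' b' /\ forall i i', b' i -> b' i' -> i = i'.
Proof.
case=> // [v l _ ub _|].
  split=> //; case E: (enum 'I_K) => [|i s] //= => [i|_ i' _].
    by have := mem_enum 'I_K i; rewrite E.
  by rewrite -E mem_enum.
case: w => //= [v l j s f|v l|v l|v l|v l f2|v l|v l|o v [|j s]] // {}w' {}b' [<- <-] //= ub.
- move=> H; split=> //; case: s H => [|j' s] H /=; case: f H => H //=.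
  + case: ifP => //= bj i; apply/negP => bi; have := H isT i bi.
    by rewrite inE => /eqP ij; rewrite ij bj in bi.
  + move=> nb i bi; have := H isT i bi; rewrite inE => /orP[/eqP ij|//].
    by rewrite -ij bi in nb.
- by case: ifP.
- move=> nb.
  have nbF i : b i = false by apply/negbTE.
  by split=> [i|i i']; rewrite !nbF !orbF => /eqP-> // /eqP->.
- by case: ifP.
- by move=> H; split=> // i i' /andP[_ bi] /andP[_]; exact: ub.
Qed.

(** The value that may turn stale at W6 is the current one, which is in [S]; clearing entries only
    makes the premises stronger. *)
Lemma wstep_stale_seen r b w w' b' S S' (p : pred 'I_K) :
  wstep r b w w' b' -> value w \in S -> {subset S <= S'} ->
  stale_seen w S p -> stale_seen w' S' p.
Proof.
case=> // [v l _ _ _ _|]; first by case: (enum _).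
case: w => //= [v l j s f|v l|v l|v l|v l f2|v l|v l|o v [|j s]] // {}w' {}b' [<- _] //=.
- by case: s; case: (f || b j).
- by case: ifP.
- by case: ifP.
- by move=> lS sS _ _ _ _; exact: sS.
- by move=> _ sS H vo os pv; apply/sS/H; rewrite // inE os orbT.
Qed.

Lemma wstep_newest r b w w' b' : wstep r b w w' b' ->
  newest w' = newest w \/ added w = 1.
Proof.
case=> // [v l -> |w1 b1|o v ->]; [|case: w => //= |by left].
  by case: (enum _); left.
- by move=> v l j s f [<- _]; left; case: s; case: (f || b j).
- by move=> v l [<- _]; left; case: ifP.
- by move=> v l [<- _]; left.
- by move=> v l [<- _]; left.
- by move=> v l f [<- _]; left; case: ifP.
- by move=> v l [<- _]; left.
- by move=> v l [<- _]; right.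
- by move=> o v [//|j s] [<- _]; left.
Qed.

(** An entry is committed only when flag[1] is read as 1 at W4. While it is 0, a tentative entry
    proceeds to [WUnset] and is withdrawn. *)
Lemma wstep_tentative r b w w' b' : wstep r b w w' b' ->
  flag1 r = false -> writer_inv w b ->
  (forall i, b i -> tentative w) -> forall i, b' i -> tentative w'.
Proof.
case=> // [v l -> _ _ H i /H //| w1 b1 |o v ->]; last by move=> _ _ H i /H.
case: w => //= [v l j s f|v l|v l|v l|v l f2|v l|v l|o v [|j s]] // [<- <-] // f1 wi H i /=;
  rewrite ?f1 ?orbT //; try by move/H.
by case/andP=> ne /wi e; rewrite e eqxx in ne.
Qed.

(** [p] stands for the entries that R5 has yet to clear. While flag[2] = 1, a writer at [WChk2]
    reads it as 1 and stays doomed, so an entry that escapes W5 was not doomed before and lies in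
    [p]. *)
Lemma wstep_doomed r b w w' b' (p : pred 'I_K) : wstep r b w w' b' ->
  flag2 r -> writer_inv w b ->
  (forall i, b i -> p i || doomed w) -> forall i, b' i -> p i || doomed w'.
Proof.
have wd b0 : (forall i, b0 i -> p i || false) -> forall i w0, b0 i -> p i || doomed w0.
  by move=> H i w0 /H; rewrite orbF => ->.
case=> // [v l -> _ _ /wd H i /H //| w1 b1 |o v -> _ _ /wd H i /H //].
case: w => //= [v l j s f|v l|v l|v l|v l f2|v l|v l|o v [|j s]] // [<- <-] // f2r wi H i /=;
  rewrite ?f2r ?orbT //; try by move/(wd _ H).
- by case: f2 H => H /=; [rewrite orbT|move/(wd _ H)].
- by case/andP=> ne /wi e; rewrite e eqxx in ne.
Qed.

(** The core of the helping mechanism: a [helped] write either has found an entry of B, or it sees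
    flag[1] = 1 and flag[2] = 0 and commits its own. *)
Lemma wstep_reading r b w w' b' n S S' :
  wstep r b w w' b' -> flag1 r -> flag2 r = false ->
  writer_inv w b -> value w \in S -> {subset S <= S'} ->
  reading w b n S -> reading w' b' (n + added w) S'.
Proof.
case=> // [v l ->|w1 b1 E|o v ->] f1 f2; last first.
- move=> _ _ sS [H1 H2 H3]; rewrite addn0; split=> // i /H1[]// /sS; by right.
- case: w E => //= [v l j s f|v l|v l|v l|v l g|v l|v l|o v [|j s]] // [<- <-] //=;
    rewrite ?f1 ?f2 ?addn0 /=.
  + move=> wi vS sS [/= H1 H2 H3]; split.
    * by move=> i /H1[]// /sS; right.
    * move=> /H2 {wi H2 H3} H; case: s => /= [|_ _].
        by case: f H => [H|_] /=; [|case: ifP => // bj]; [exact: H|exists j].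
      by case/orP=> // bj; exists j.
    * move=> /H3[_ Hb]; split=> //; by case: s {wi H2 Hb}; case: (f || b j).
  + move=> wi vS sS [/= H1 H2 H3]; split=> // i bi; by have := wi i; rewrite bi.
  + move=> wi vS sS [/= H1 H2 H3]; split; first by left.
      by rewrite /= eqxx.
    by move/H3=> [_ [i bi]]; have := wi i; rewrite bi.
  + move=> wi vS sS [/= H1 H2 H3]; split=> //; first by left.
    by move/H2.
  + move=> wi vS sS [/= H1 H2 H3]; split.
    (* An entry committed here is [l], the present value of the register. *)
    * move=> i bi; case: g H1 H2 {H3} => H1 H2; first by left.
      by right; apply: sS; rewrite (wi i bi).
    * by move/H2=> [bl ng]; rewrite (negbTE ng) /=; exists l.
    * by move/H3=> [].
  + move=> wi vS sS [/= H1 H2 H3]; split.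
    * by move=> i /andP[ne /wi e]; rewrite e eqxx in ne.
    * by move/H2.
    * by move/H3=> [].
  + move=> wi vS sS [/= H1 H2 H3]; split=> // [i /H1[]// /sS|]; first by right.
    (* This step is W6. If another W6 preceded it since R1, the write was [helped] and an entry is
       set. *)
    by rewrite addn1 ltnS => /H2 bi; split.
  + move=> wi vS sS [/= H1 H2 H3]; split=> // i /H1[]// /sS; by right.
- move=> _ _ sS [H1 H2 H3]; rewrite addn0; split=> [i /H1[]// /sS|/H2|/H3[_ bi]]; first by right.
    by case: (enum _).
  by split=> //; case: (enum _).
Qed.

(** The writer changes B only at [WSet], where B is empty, and at [WUnset], where it is tentative.
    So R3 reads a B that does not change. *)
Lemma wstep_stable r b w w' b' : wstep r b w w' b' -> writer_inv w b ->
  ~~ tentative w -> (exists i, b i) -> b' = b.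
Proof.
case=> // w1 b1; case: w => //= [v l j s f|v l|v l|v l|o v [|j s]] //;
  case=> _ <- // wi _ [i bi]; by have := wi i; rewrite bi.
Qed.

Lemma wstep_reader_inv r b w w' b' n S S' :
  wstep r b w w' b' -> wclr_ok w -> writer_inv w b -> value w \in S ->
  {subset S <= S'} -> value w' \in S' ->
  reader_inv r w b n S ->
  reader_inv r w' b' (if r is RStart then 0 else n + added w) S'.
Proof.
move=> st ok wi vS sS vS'.
have ex2 val : (exists2 i, val = Some i & i \in S) ->
    exists2 i, val = Some i & i \in S'.
  by case=> i -> /sS; exists i.
have dm := wstep_doomed st _ wi.
have tn := wstep_tentative st _ wi.
have rdg f1 f2 H := wstep_reading (n := n) st f1 f2 wi vS sS H.
have ss p := wstep_stale_seen (p := p) st vS sS.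
case: r st dm tn rdg => [||a j s|a j s val|j s val|val|j s val|val|val|val] st dm tn rdg /=.
- exact: (tn erefl).
- by case=> _ /(tn erefl).
- case=> /(rdg erefl erefl) rd pj /ss sj an nj; split=> //.
    exact: leq_trans an (leq_addr _ _).
  case: (wstep_newest st) => [->|->]; last by left; rewrite addn1.
  by case: nj => [/(ltn_addr _)|]; [left|right].
- case=> /(rdg erefl erefl) rd jv pj /ss sj H; split=> //.
  case: H => [/sS|[y [s' [Ew ys yv yj]]]]; first by left.
  case: st ok vS' => [v l|w1 b1|o v]; rewrite Ew //=.
    (* If the entry being cleared is [y], then [val] becomes the current value. *)
    case: s' ys Ew => //= k s'; rewrite inE => yk Ew [<- _] /andP[/andP[ks us] vs] /=.
    case: ifP => [/andP[_ ys'] _|ny ]; first by right; exists y, s'.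
    by left.
  by case=> _ _ Es; rewrite Es in ys.
- case=> [[rd n1 H1] H2].
  have [_ _ /(_ n1)[nt eb]] := rd.
  have Eb := wstep_stable st wi nt eb.
  split; [split=> //; try exact: (rdg erefl erefl)|]; rewrite ?Eb //.
  exact/ltn_addr.
- case=> /(rdg erefl erefl) rd /ex2; split=> //.
- case=> /(dm (mem (j :: s)) isT) H /ex2 e; split=> //; exact: H.
- case=> H /ex2 e; split=> //; exact: (dm pred0 isT).
- case=> H /ex2 e; split=> //; exact: (dm pred0 isT).
- by case=> /(tn erefl) H /ex2.
Qed.

(** * Steps of the reader *)

Lemma Aof_newest w : Aof w (newest w).
Proof. by case: w => //= *; rewrite eqxx. Qed.

Lemma stale_seen_sub w S (p q : pred 'I_K) :
  subpred q p -> stale_seen w S p -> stale_seen w S q.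
Proof. by move=> qp; case: w => //= o v s H vo os /qp; exact: H vo os. Qed.

(** If A holds nothing smaller than [i], then [i] is the current value. Otherwise either [i] is the
    newer of the two values, or the newer one is smaller and was passed over, so that [stale_seen]
    applies to [i]. *)
Lemma found_seen w S (p : pred 'I_K) i :
  Aof w i -> value w \in S -> stale_seen w S p ->
  (forall v, v < i -> p v) ->
  i \in S \/ exists y s, [/\ w = WClr y i s, y \in s & y < i].
Proof.
case: w; try by move=> *; left; match goal with H : is_true (Aof _ _) |- _ => rewrite (eqP H) end.
move=> o v s /= /orP[/eqP->|/andP[/eqP-> os]].
  by case: ifP => [/andP[ov os]|] vS *; [right; exists o, s|left].
rewrite os andbT => vS H P; left; case: (ltngtP o v) vS => // [vo _|/val_inj->] //.
exact: H vo isT (P v vo).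
Qed.

Lemma enum_sorted : sorted [rel i i' : 'I_K | i < i'] (enum 'I_K).
Proof.
have := iota_ltn_sorted 0 K; rewrite -val_enum_ord sorted_map.
by apply: sub_sorted.
Qed.

Lemma below_sorted i : sorted [rel i i' : 'I_K | i' < i] (below i).
Proof.
rewrite rev_sorted; apply: sorted_filter enum_sorted => x y z /=; exact: ltn_trans.
Qed.

(** R3 ends with [val] defined: after two W6 some entry of B is committed, the scan cannot have
    missed it, and a committed entry is in [S]. *)
Lemma rscan_inv w b n S s val :
  reading w b n S -> 1 < n -> (forall i, b i -> i \notin s -> val = Some i) ->
  (forall i, val = Some i -> b i) -> reader_inv (rscan s val) w b n S.
Proof.
move=> rd n1; case: s => [|j s] H1 H2 //=; split=> //.
have [H _ /(_ n1)[nt [i bi]]] := rd; exists i; first exact: H1.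
by case: (H i bi) => // t; rewrite t in nt.
Qed.

(** When a scan is exhausted, [newest] is not ahead of it, so a W6 occurred during this TryRead; the
    second failure thus yields the two W6 that R3 relies on. *)
Lemma rup_inv w b n S (again : bool) s :
  reading w b n S -> sorted [rel i i' : 'I_K | i < i'] s ->
  stale_seen w S [predC s] -> again <= n -> again < n \/ newest w \in s ->
  reader_inv (rup again s) w b n S.
Proof.
have E2 : reading w b n S -> 1 < n -> reader_inv (rscan (enum 'I_K) None) w b n S.
  by move=> rd n1; apply: rscan_inv => // i _; rewrite mem_enum.
have R2 t : reading w b n S -> sorted [rel i i' : 'I_K | i < i'] t ->
    stale_seen w S [predC t] -> 0 < n -> 1 < n \/ newest w \in t ->
    reader_inv (rup2 t) w b n S.
  move=> rd; case: t => [_ _ _ [n1|//]|j t pj ss n0 nj]; last by split.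
  exact: E2.
case: again; first exact: R2.
case: s => [|j s] rd ps ss n0 nj; last by split.
have n1 : 0 < n by case: nj.
rewrite /=; apply: R2 => //; first exact: enum_sorted.
  by apply: stale_seen_sub ss => i /=; rewrite mem_enum.
by right; rewrite mem_enum.
Qed.

(** At the end of the scan no older value can be ahead, so [val] itself is in [S]. *)
Lemma rdown_inv w b n S again s (val : 'I_K) :
  reading w b n S -> (forall i, i \in s -> i < val) ->
  sorted [rel i i' : 'I_K | i' < i] s ->
  (forall i (y : 'I_K), i \in s -> y < i -> y \in s) ->
  stale_seen w S [pred i : 'I_K | i < val] ->
  val \in S \/ (exists y s', [/\ w = WClr y val s', y \in s', y < val & y \in s]) ->
  reader_inv (rdown again s val) w b n S.
Proof.
move=> rd; case: s => [|j s] sv ps cs ss H /=.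
  by split=> //; exists val => //; case: H => // [[y [s' []]]].
split=> //; split=> // i ij.
have := cs j i (mem_head _ _) ij; rewrite inE => /orP[/eqP e|//].
by rewrite e ltnn in ij.
Qed.

Lemma rprim_inv r b w r' b' n S :
  rprim w b r = Some (r', b') -> writer_inv w b ->
  (forall i i', b i -> b i' -> i = i') -> value w \in S ->
  reader_inv r w b n S ->
  [/\ writer_inv w b', forall i i', b' i -> b' i' -> i = i' & reader_inv r' w b' n S].
Proof.
move=> E wi ub vS; case: r E => // [|a j s|a j s val|j s val|val|j s val|val|val] [<- <-].
- case=> -> tn; split=> //; apply: (@rup_inv _ _ _ _ false) => //.
  + by split=> // i /tn; left.
  + exact: enum_sorted.
  + by case: (w) => // o v t _ _ /=; rewrite mem_enum.
  + by right; rewrite mem_enum.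
- case=> rd pj ss an nj; split=> //; case: ifP => Aj.
    have lt i : i < j -> [predC j :: s] i.
      move=> ij; rewrite /= inE negb_or neq_ltn ij /=; apply/negP => iS.
      have /allP/(_ i iS) /= := order_path_min (fun _ _ _ => @ltn_trans _ _ _) pj.
      by rewrite ltnNge ltnW.
    apply: rdown_inv => //.
    * by move=> i; rewrite mem_below.
    * exact: below_sorted.
    * by move=> i y; rewrite !mem_below => ij yi; exact: ltn_trans yi ij.
    * exact: stale_seen_sub ss.
    * have [|[y [t [Ew yt yj]]]] := found_seen Aj vS ss lt; first by left.
      by right; exists y, t; rewrite mem_below.
  apply: rup_inv => //.
  + exact: path_sorted pj.
  (* Passing [j] creates no new case: A[[v]] is 1 whereas A[[j]] was just read as 0, so [j] is not
     [v]. *)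
  + case: w {wi vS rd nj} Aj ss => // o v t /= Aj H vo ot vs.
    apply: H => //; rewrite inE negb_or vs andbT; apply/eqP => vj.
    by rewrite vj eqxx in Aj.
  + case: nj => [|]; first by left.
    rewrite inE => /orP[/eqP e|]; last by right.
    by rewrite -e Aof_newest in Aj.
- case=> rd sv [pj dj] ss H; split=> //.
  have js i : i \in s -> i < j.
    move=> iS.
    by have /allP/(_ i iS) := order_path_min (fun _ _ _ h1 h2 => ltn_trans h2 h1) pj.
  have jv : j < val by apply: sv; rewrite mem_head.
  have cs i (y : 'I_K) : i \in s -> y < i -> y \in s.
    by move=> /js ij yi; apply: dj; exact: ltn_trans yi ij.
  apply: rdown_inv => //.
  + move=> i iS; case: ifP => _; first exact: js.
    by apply: sv; rewrite inE iS orbT.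
  + exact: path_sorted pj.
  + by case: ifP => // _; apply: stale_seen_sub ss => i /= ij; exact: ltn_trans ij jv.
  + case: ifP => Aj.
      have lt i : i < j -> [pred i : 'I_K | i < val] i by move=> /= ij; exact: ltn_trans ij jv.
      have [|[y [t [Ew yt yj]]]] := found_seen Aj vS ss lt; first by left.
      by right; exists y, t; split=> //; exact: dj.
    case: H => [|[y [t [Ew yt yv]]]]; first by left.
    (* [y] is still set, so it is not the entry just read as 0. *)
    rewrite inE => /orP[/eqP e|yS]; last by right; exists y, t.
    by rewrite Ew -e /= eqxx yt orbT in Aj.
- case=> [[rd n1 H1] H2]; split=> //; apply: rscan_inv => // i.
  (* At most one entry of B is set, so a later entry cannot overwrite the one found. *)
  + move=> bi iS; case: ifP => bj; first by rewrite (ub i j).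
    by apply: H1 => //; rewrite inE negb_or iS andbT; apply/eqP => e; rewrite -e bi in bj.
  + by case: ifP => bj; [case=> <-|exact: H2].
- case=> rd ev; split=> //; case E: (enum 'I_K) => [|j s] /=.
    by split=> // i; have := mem_enum 'I_K i; rewrite E.
  by split=> // i; rewrite -E mem_enum.
- case=> H ev; split.
  + case: w {H vS} wi => //= [v l j' s' f H nf i /andP[_]|v l H i|v l H i|v l H i /andP[_]
      |v l f H i /andP[_]|v l H i /andP[_]]; try exact: H.
    1, 2: by rewrite (negbTE (H i)) andbF.
  + by move=> i i' /andP[_ bi] /andP[_]; exact: ub.
  + have H' i : (i != j) && b i -> (i \in s) || doomed w.
      by case/andP=> ij /H; rewrite inE (negbTE ij).
    by case: s H H' => [|j' s] /= _ H'; split.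
- by [].
(* After R7, flag[2] no longer dooms the writer; that a tentative entry will be withdrawn now rests
   on flag[1] = 0. *)
- case=> H ev; split=> //; split=> // i /H; by case: (w).
Qed.

End Invariant.

(** * Preservation of the invariant by every event *)

Section Steps.

Context (K : nat) (v0 : 'I_K).

Local Notation event := (@event (register v0) role).
Local Notation astate := (astate K).

Lemma inv_start : wf_inv (astart v0).
Proof. by split=> //=; rewrite inE. Qed.

Lemma wstep_inv (x : astate) w b S : wf_inv x -> wstep (rp x) (bm x) (wp x) w b ->
  {subset seen x <= S} -> value w \in S ->
  wf_inv (AState w (rp x) b (if rp x is RStart then 0 else adds x + added (wp x)) S).
Proof.
move=> [ok wi ub vS ri] st sS vS'.
have [wi' ub'] := wstep_writer_inv st ub wi.
split=> //=; first exact: wstep_wclr_ok st ok.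
exact: (wstep_reader_inv st ok wi vS sS vS' ri).
Qed.

Lemma reader_inv_sub (r : rpc K) w b n S S' : {subset S <= S'} ->
  reader_inv r w b n S -> reader_inv r w b n S'.
Proof.
move=> sS.
have rd : reading w b n S -> reading w b n S'.
  by case=> H1 H2 H3; split=> // i /H1[]; [left|right; exact: sS].
have ss (p : pred 'I_K) : stale_seen w S p -> stale_seen w S' p.
  by case: (w) => //= o v s H h1 h2 h3; exact: sS (H h1 h2 h3).
have ex2 val : (exists2 i, val = Some i & i \in S) ->
    exists2 i, val = Some i & i \in S'.
  by case=> i -> /sS; exists i.
case: r => //=.
- by move=> again j s [/rd ? ? /ss].
- by move=> again j s val [/rd ? ? ? /ss ? [/sS|?]]; split=> //; [left|right].
- by move=> j s val [[/rd]].
- by move=> val [/rd ? /ex2].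
- by move=> j s val [? /ex2].
- by move=> val [? /ex2].
- by move=> val [? /ex2].
- by move=> val [? /ex2].
Qed.

Lemma inv_step (x x' : astate) (e : event) : astep x e = Some x' -> wf_inv x -> wf_inv x'.
Proof.
rewrite /astep; case E: (core_step x e) => [[[w r] b]|//] [<-] ix.
have sS : {subset seen x <= value w :: seen x} by move=> i iS; rewrite inE iS orbT.
have vS := mem_head (value w) (seen x).
case: e E sS vS => [p o|p|p o].
- case: p o => [] [|v] //=.
  + case Ew: (wp x) => [l||||||||] // [<- <- <-] sS vS.
    by have := wstep_inv ix (wstep_start (rp x) (bm x) v Ew) sS vS; rewrite Ew.
  + case Er: (rp x) => // -[<- <- <-] _ _; case: ix => ok wi ub _.
    by rewrite Er => ri; split=> //=; rewrite inE.
- case: p => /=.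
  + case Ew: (wprim _ _ _) => [[w' b']|//] [<- <- <-] sS vS.
    exact: wstep_inv ix (wstep_prim Ew) sS vS.
  + case Er: (rprim _ _ _) => [[r' b']|//] [<- <- <-] sS vS.
    case: ix => ok wi ub vx /(reader_inv_sub sS) ri.
    have [wi' ub' ri'] := rprim_inv Er wi ub vS ri.
    split=> //=; rewrite addn0; case: (r') ri' => // -[_ tn]; by split.
- case: p o => [] [v|] //=.
  + case Ew: (wp x) => [||||||||o v [|//]] // [<- <- <-] sS vS.
    by have := wstep_inv ix (wstep_return (rp x) (bm x) Ew) sS vS; rewrite Ew.
  + case Er: (rp x) => [|||||||||v'] //; case: eqP => // _ [<- <- <-] sS vS.
    case: ix => ok wi ub vx; rewrite Er /= => -[tn _]; by split.
  + case Er: (rp x) => [|||||||||v'] //; case: eqP => // _ [<- <- <-] sS vS.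
    case: ix => ok wi ub vx; rewrite Er /= => -[tn _]; by split.
Qed.

End Steps.

(** * Linearization points *)

(** By excluded middle and indefinite description; it yields both the placement of the points and
    the completion. *)
Lemma partial_function (S T : Type) (R : S -> T -> Prop) :
  (forall n x y, R n x -> R n y -> x = y) ->
  exists g : S -> option T, forall n x, g n = Some x <-> R n x.
Proof.
move=> fR.
have ex n : exists o : option T, forall x, o = Some x <-> R n x.
  case: (classic (exists x, R n x)) => [[x Rx]|no].
    by exists (Some x) => y; split=> [[<-]|/(fR _ _ _ Rx)->].
  by exists None => x; split=> // Rx; case: no; exists x.
exists (fun n => proj1_sig (constructive_indefinite_description _ (ex n))) => n.
by case: constructive_indefinite_description.
Qed.

Section Points.

Context (T : Type) (g : nat -> option T).

Definition points (k : nat) : seq T := pmap g (iota 0 k).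

Lemma pointsS k :
  points k.+1 = if g k is Some x then rcons (points k) x else points k.
Proof.
rewrite /points -addn1 iotaD pmap_cat add0n /=.
by case: (g k) => [x|] /=; rewrite ?cats0 ?cats1.
Qed.

Lemma points_prefix k l : k <= l -> exists t, points l = points k ++ t.
Proof.
by move=> /subnKC <-; rewrite /points iotaD pmap_cat; eexists.
Qed.

Lemma size_points_le k l : k <= l -> size (points k) <= size (points l).
Proof. by case/points_prefix=> t ->; rewrite size_cat leq_addr. Qed.

Lemma size_points_lt k l x :
  g k = Some x -> k < l -> size (points k) < size (points l).
Proof.
by move=> gk /size_points_le; rewrite pointsS gk size_rcons.
Qed.

Lemma onth_points k n x : onth (points k) n = Some x ->
  exists l, [/\ l < k, g l = Some x & points l = take n (points k)].
Proof.
elim: k => [|k IH]; first by rewrite /points onthE /= nth_nil.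
rewrite pointsS; case E: (g k) => [y|]; last first.
  by case/IH=> l [lk gl Pl]; exists l; rewrite ltnW ?ltnS.
rewrite onthE map_rcons nth_rcons size_map.
case: ltngtP => // [nk|->].
  rewrite -onthE => /IH [l [lk gl Pl]]; exists l; split; rewrite ?ltnS ?(ltnW lk) //.
  by rewrite -cats1 takel_cat ?(ltnW nk).
by case=> <-; exists k; rewrite ltnSn -cats1 take_size_cat.
Qed.

(** The trace is finite if [g] is eventually undefined. Otherwise the prefixes grow beyond any
    length, and entry [n] can be read off any prefix longer than [n]. *)
Lemma points_trace :
  exists s : trace T,
    [/\ forall n x, tr_nth s n = Some x ->
          exists l, g l = Some x /\ points l = tr_take n s,
        forall l x, g l = Some x -> tr_nth s (size (points l)) = Some x
      & forall s', s = Fin s' -> exists N, forall M, N <= M -> s' = points M].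
Proof.
have onth_at l k x : g l = Some x -> l < k -> onth (points k) (size (points l)) = Some x.
  move=> gl /points_prefix[t ->]; rewrite pointsS gl onthE.
  by rewrite map_cat map_rcons nth_cat size_rcons size_map ltnSn nth_rcons size_map ltnn eqxx.
case: (classic (exists N, forall k, N <= k -> g k = None)) => [[N gN]|inf].
  have le l x : g l = Some x -> l < N.
    by move=> gl; rewrite ltnNge; apply/negP => /gN; rewrite gl.
  exists (Fin (points N)); split.
  - by move=> n x /onth_points[l [_ gl Pl]]; exists l.
  - by move=> l x gl; exact: onth_at gl (le _ _ gl).
  - move=> s' [<-]; exists N => M NM; elim: M NM => [|M IH].
      by rewrite leqn0 => /eqP->.
    rewrite leq_eqVlt => /orP[/eqP-> //|]; rewrite ltnS => NM.
    by rewrite pointsS gN // IH.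
have big n : exists k, n < size (points k).
  elim: n => [|n [k IH]].
    apply: NNPP => no; apply: inf; exists 0 => k _; case E: (g k) => [x|//].
    by case: no; exists k.+1; rewrite pointsS E size_rcons.
  apply: NNPP => no; apply: inf; exists k => l kl; case E: (g l) => [x|//].
  case: no; exists l.+1; rewrite pointsS E size_rcons ltnS.
  exact: leq_trans IH (size_points_le kl).
(* Only a default value for [nth]. *)
have [x0 _] : exists x : T, True.
  by have [k] := big 0; case: (points k) => // x; exists x.
pose f n := nth x0 (points (ex_minn (big n))) n.
have fE n k : n < size (points k) -> f n = nth x0 (points k) n.
  rewrite /f; case: ex_minnP => m nm min nk.
  have [t ->] := points_prefix (min k nk).
  by rewrite nth_cat nm.
have tkE n k : n <= size (points k) -> mkseq f n = take n (points k).
  move=> nk; apply: (@eq_from_nth _ x0); rewrite size_mkseq ?size_takel // => i in_.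
  by rewrite nth_mkseq // nth_take // (fE i k) // (leq_trans in_).
exists (Inf f); split=> //= n x.
- case=> <-; have [k nk] := big n.
  have /onth_points[l [lk gl Pl]] : onth (points k) n = Some (f n).
    by rewrite (fE _ _ nk) onthE (nth_map x0).
  by exists l; rewrite (tkE n k) // ltnW.
- move=> gn; rewrite (fE _ n.+1) ?pointsS gn ?size_rcons //.
  by rewrite nth_rcons ltnn eqxx.
Qed.

End Points.

Section LinearizationPoints.

Context {obj : object} {P : finType} {may : P -> op obj -> bool}
        {I : finType} {base : I -> object} (imp : implementation may base).

(* Position [n] of the history has the points [n.*2] (configuration) and
   [n.*2.+1] (step). *)
Lemma linearization_of_points (a : trace (event * config imp))
    (g : nat -> option (@seq_op obj P)) :
  (forall k x, g k = Some x -> invoked a (sid x) (sproc x) (sop x)) ->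
  (forall k l x y, g k = Some x -> g l = Some y -> sid x = sid y -> k = l) ->
  (forall n m r, returns a n m r ->
     exists k x, [/\ g k = Some x, sid x = n & sresp x = r]) ->
  (forall k x, g k = Some x -> (sid x).*2.+1 < k) ->
  (forall k x j r, g k = Some x -> returns a (sid x) j r -> k <= j.*2.+1) ->
  (forall k x, g k = Some x ->
     sresp x = (delta (state_of (points g k)) (sop x)).2) ->
  exists2 s, linearization a s
    & forall s', s = Fin s' -> exists N, forall M, N <= M -> s' = points g M.
Proof.
move=> Hinv Huniq Hret Hlo Hhi Hleg.
have [s [s1 s2 s3]] := points_trace g; exists s => //.
have loc n x : tr_nth s n = Some x ->
    exists l, [/\ g l = Some x, points g l = tr_take n s & n = size (points g l)].
  move=> /[dup] E /s1[l [gl Pl]]; exists l; split=> //; rewrite Pl.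
  case: (s) E => [t|f] /=; last by rewrite size_mkseq.
  by rewrite onthE size_take; case: ltnP => // tn; rewrite nth_default ?size_map.
(* The completion keeps exactly the operations that have a point. *)
have [c cP] : exists c : nat -> option (resp obj), forall n r,
    c n = Some r <-> exists k x, [/\ g k = Some x, sid x = n & sresp x = r].
  apply: partial_function => n r r' [k [x [gk xn <-]]] [l [y [gl yn <-]]].
  have e := Huniq _ _ _ _ gk gl (etrans xn (esym yn)).
  by move: gk; rewrite e gl => -[->].
split; last 2 first.
- by move=> n x /loc[l [gl <- _]]; exact: Hleg.
- move=> n m x y j r /loc[k [gk _ ->]] /loc[l [gl _ ->]] ret jy.
  (* The point of [x] is at most [j.*2.+1], the time of its return, and that of [y] exceeds the time
     of its later invocation. *)
  apply: (size_points_lt gk); apply: leq_ltn_trans (Hhi _ _ _ _ gk ret) _.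
  apply: leq_trans (Hlo _ _ gl); rewrite ltnS ltnS leq_double; exact: ltnW.
exists c; split; first split.
- move=> n; case E: (c n) => [r|//] _; move/cP: E => [k [x [gk <- _]]].
  by exists (sproc x), (sop x); exact: Hinv gk.
- by move=> n m r /Hret H; apply/cP.
split.
- move=> n x /loc[l [gl _ _]]; split; first exact: Hinv gl.
  by apply/cP; exists l, x.
- move=> n m x y /loc[k [gk _ ->]] /loc[l [gl _ ->]] e.
  by rewrite (Huniq _ _ _ _ gk gl e).
- move=> i; case E: (c i) => [r|//] _; move/cP: E => [k [x [gk xi _]]].
  by exists (size (points g k)), x; split=> //; exact: s2.
Qed.

End LinearizationPoints.

(** * Wait-freedom *)

Section Traces.

Context {obj : object} {P : finType} {may : P -> op obj -> bool}
        {I : finType} {base : I -> object} (imp : implementation may base).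
Context (a : trace (@event obj P * config imp)).

(** Past the end of a finite trace this is constant, so that finite and infinite executions are
    treated alike. *)
Definition config_at (n : nat) : config imp := last_config (tr_take n a).

Lemma config_atS n e c : tr_nth a n = Some (e, c) -> config_at n.+1 = c.
Proof.
rewrite /config_at /last_config /tr_take /tr_nth; case: a => [l|f].
  rewrite onthE => E.
  have nl : n < size l.
    by rewrite ltnNge; apply/negP => h; rewrite nth_default ?size_map in E.
  rewrite (take_nth (e, c)) // map_rcons last_rcons.
  by rewrite (nth_map (e, c)) // in E; case: E => ->.
by case=> E; rewrite mkseqS map_rcons last_rcons E.
Qed.

Lemma config_at_stop n : tr_nth a n = None -> config_at n.+1 = config_at n.
Proof.
rewrite /config_at; case: a => [l|f] //=; rewrite onthE => E.
have nl : size l <= n.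
  rewrite leqNgt; apply/negP => h.
  by case: l h E => // x l h; rewrite (nth_map x).
by rewrite !take_oversize // ltnW.
Qed.

End Traces.

Lemma step_other {obj : object} {P : finType} {may : P -> op obj -> bool}
    {I : finType} {base : I -> object} (imp : implementation may base)
    (c c' : config imp) (e : @event obj P) (p : P) :
  step c e c' -> proc_of e != p -> loc c' p = loc c p.
Proof. by case=> /= *; rewrite dfwith_out. Qed.

(** A program is a well-founded tree and each step of its process moves to a subtree, so induction
    on the remaining program suffices. *)
Lemma WF_wait_free (K : nat) (v0 : 'I_K) : wait_free (WF v0).
Proof.
move=> a ex n p o inv.
have st N : step (config_at (Inf a) N) (a N).1 (config_at (Inf a) N.+1).
  have E : tr_nth (Inf a) N = Some ((a N).1, (a N).2) by rewrite /=; case: (a N).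
  by rewrite (config_atS E); exact: ex E.
have ev N : event_at (Inf a) N (a N).1 by [].
suff main (m : wf_busy K p) : forall N, n < N ->
    loc (config_at (Inf a) N) p = inr m ->
    (forall k r, n < k < N -> ~ event_at (Inf a) k (Respond p r)) ->
    (exists (m : nat) (r : resp (register v0)), returns (Inf a) n m r) \/
    (exists N : nat, forall m : nat, N <= m -> proc_of (a m).1 <> p).
  case: inv => E; have := st n; rewrite E => /stepE[po [l [_ Ec]]].
  apply: (main (@wf_start K p o po l) n.+1) => //.
    by rewrite Ec /= /set_loc dfwith_in.
  by move=> k r; rewrite ltnS => /andP[nk /(leq_trans nk)]; rewrite ltnn.
have next M N m' : n < N -> N <= M -> loc (config_at (Inf a) N) p = inr m' ->
    (forall k, N <= k < M -> proc_of (a k).1 != p) ->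
    loc (config_at (Inf a) M) p = inr m'.
  move=> nN /subnKC <-; elim: (M - N) => [|d IH] El; first by rewrite addn0.
  rewrite addnS => no; rewrite (step_other (st _)).
    by apply: IH => // k /andP[Nk kN]; apply: no; rewrite Nk ltnS ltnW.
  by apply: no; rewrite leq_addr ltnSn.
(* Either the process takes a further step, the first one being at [M], or it never steps again. *)
have wait (m' : wf_busy K p) N : n < N -> loc (config_at (Inf a) N) p = inr m' ->
    (forall k r, n < k < N -> ~ event_at (Inf a) k (Respond p r)) ->
    (exists M, [/\ n < M, proc_of (a M).1 = p, loc (config_at (Inf a) M) p = inr m' &
      forall k r, n < k < M -> ~ event_at (Inf a) k (Respond p r)]) \/
    (exists N : nat, forall m : nat, N <= m -> proc_of (a m).1 <> p).
  move=> nN El nr.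
  case: (classic (exists M, (N <= M) && (proc_of (a M).1 == p))) => [eM|no]; last first.
    by right; exists N => k Nk e; apply: no; exists k; rewrite Nk e eqxx.
  left; case: (ex_minnP eM) => M /andP[NM /eqP pM] min.
  have np k : N <= k < M -> proc_of (a k).1 != p.
    case/andP=> Nk kM; apply/negP => pk; have := min k; rewrite Nk pk => /(_ isT).
    by rewrite leqNgt kM.
  exists M; split=> //; first exact: leq_trans nN NM.
    exact: next NM El np.
  move=> k r /andP[nk kM]; case: (ltnP k N) => [kN|Nk]; first by apply: nr; rewrite nk.
  by case=> E; have := np k; rewrite Nk kM E eqxx => /(_ isT).
elim: m => [[r l]|c k IH|c b m IH] N nN El nr.
all: case: (wait _ N nN El nr) => [[M [nM pM ElM nrM]]|]; last by right.
all: case E: (a M).1 pM => [q o'|q|q r'] /= pM; subst q.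
all: have := st M; rewrite E => /stepE.
- by case=> po [l' []]; rewrite ElM.
- by case=> l' []; rewrite ElM => -[<-].
- case=> l1 [l2 [_ _ _]]; left; exists M, r', p, o; split=> //.
  by rewrite /event_at /= E.
- by case=> po [l' []]; rewrite ElM.
- case=> l' []; rewrite ElM => -[<-] /= [Ec].
  apply: (IH _ M.+1) => //; first exact: ltnW.
    by rewrite -Ec /= /set_loc dfwith_in.
  move=> j s; rewrite ltnS (leq_eqVlt j) => /andP[nj /orP[/eqP->|jM]]; last first.
    by apply: nrM; rewrite nj.
  by case; rewrite E.
- by case=> l1 [l2 []]; rewrite ElM => -[<-].
- by case=> po [l' []]; rewrite ElM.
- case=> l' []; rewrite ElM => -[<-] /= [Ec].
  apply: (IH M.+1) => //; first exact: ltnW.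
    by rewrite -Ec /= /set_loc dfwith_in.
  move=> j s; rewrite ltnS (leq_eqVlt j) => /andP[nj /orP[/eqP->|jM]]; last first.
    by apply: nrM; rewrite nj.
  by case; rewrite E.
- by case=> l1 [l2 []]; rewrite ElM => -[<-].
Qed.

(** * Linearization of executions of WF *)

Section LinearizationOfWF.

Context (K : nat) (v0 : 'I_K).

Local Notation event := (@event (register v0) role).
Local Notation astate := (astate K).

Definition busy_in (p : role) (x : astate) : bool :=
  match p with
  | Writer => if wp x is WIdle _ then false else true
  | Reader => if rp x is RIdle then false else true
  end.

Definition argument (w : wpc K) : 'I_K :=
  match w with
  | WIdle l => l
  | WScan v _ _ _ _ | WFlag v _ | WSet v _ | WChk2 v _ | WChk1 v _ _
  | WUnset v _ | WAdd v _ | WClr _ v _ => v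
  end.

Definition op_in (p : role) (x : astate) : reg_op 'I_K :=
  if p is Writer then Write (argument (wp x)) else Read.

(** Whether the latest write has taken effect: at W6 if its argument is at most the old value, and
    otherwise when the old entry is cleared in W7. Defined from the counter, since a write of the
    present value does not change [value]. *)
Definition effective (x : astate) : bool :=
  match wp x with
  | WIdle _ => true
  | WClr o v s => ~~ ((o < v) && (o \in s))
  | _ => false
  end.

Lemma astep_busy (x x' : astate) (e : event) (p : role) :
  astep x e = Some x' ->
  busy_in p x' = match e with
    | Invoke q _ => (q == p) || busy_in p x
    | Respond q _ => (q != p) && busy_in p x
    | Prim _ => busy_in p x
    end.
Proof.
rewrite /astep; case E: core_step => [[[w r] b]|//] [<-].
case: e E => [q o|q|q o].
- case: q o => [] [|v] //=; case: p => //=.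
  + by case: (wp x) => // l [<- _ _]; case: (enum _).
  + by case: (wp x) => // l [_ <- _].
  + by case: (rp x) => // -[<- _ _].
  + by case: (rp x) => // -[_ <- _].
- case: q => /=.
  + case E: (wprim _ _ _) => [[w' b']|//] [<- <- _]; case: p => //=.
    case: (wp x) E => //= [v l j s f|v l|v l|v l|v l g|v l|v l|o v [|j s]] // [<- _] //.
    * by case: s; case: (_ || _).
    * by case: ifP.
    * by case: ifP.
  + case E: (rprim _ _ _) => [[r' b']|//] [<- <- _]; case: p => //=.
    case: (rp x) E => // [|a j s|a j s val|j s val|val|j s val|val|val] [<- _] //=.
    * by rewrite /rup2 /rscan; case: (enum 'I_K).
    * by case: ifP => _; [case: (below j)|case: (a); case: s => //=];
        rewrite /rup2 /rscan; case: (enum 'I_K).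
    * by case: s.
    * by case: s.
    * by case: (enum _).
    * by case: s.
- case: q o => [] [v|] //=; case: p => //=.
  + by case: (wp x) => // o v [|//] [<- _ _].
  + by case: (wp x) => // o v [|//] [_ <- _].
  + by case: (rp x) => // v'; case: eqP => // _ [<- _ _].
  + by case: (rp x) => // v'; case: eqP => // _ [_ <- _].
  + by case: (rp x) => // v'; case: eqP => // _ [<- _ _].
  + by case: (rp x) => // v'; case: eqP => // _ [_ <- _].
Qed.

Lemma astep_enabled (x x' : astate) (e : event) : astep x e = Some x' ->
  match e with
  | Invoke q o => ~~ busy_in q x /\ op_in q x' = o
  | Respond q r =>
      [/\ busy_in q x, (if q is Writer then r = None else rp x = RDone r)
        & q = Writer -> effective x]
  | Prim _ => True
  end.
Proof.
rewrite /astep; case E: core_step => [[[w r] b]|//] [<-].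
case: e E => [q o|//|q o].
- case: q o => [] [|v] //=.
  + by case: (wp x) => // l [<- _ _]; split=> //; case: (enum _).
  + by case: (rp x).
- case: q o => [] [v|] //=.
  + by rewrite /effective; case: (wp x) => // o v [|//] _; rewrite in_nil andbF.
  + by case: (rp x) => // v'; case: eqP => // <-.
  + by case: (rp x) => // v'; case: eqP => // <-.
Qed.

Lemma astep_seen (x x' : astate) (e : event) : astep x e = Some x' ->
  seen x' = value (wp x') :: (if e is Invoke Reader _ then [::] else seen x).
Proof. by rewrite /astep; case: core_step => [[[w r] b]|//] [<-]. Qed.

Lemma astep_value (x x' : astate) (e : event) : astep x e = Some x' ->
  [/\ value (wp x') =
        if ~~ effective x && effective x' then argument (wp x) else value (wp x),
      if e is Invoke Writer _ then ~~ effective x' else effective x -> effective x'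
    & busy_in Writer x -> busy_in Writer x' ->
      argument (wp x') = argument (wp x)].
Proof.
rewrite /astep; case E: core_step => [[[w r] b]|//] [<-].
case: x E => wx rx bx n S E; rewrite /effective /=.
have same : w = wx ->
   [/\ value w =
        (if ~~ effective (AState wx rx bx n S) && effective (AState w rx bx n S)
         then argument wx else value wx),
    effective (AState wx rx bx n S) -> effective (AState w rx bx n S) &
    (if wx is WIdle _ then false else true) ->
      (if w is WIdle _ then false else true) -> argument w = argument wx].
  by move=> ->; split=> //; rewrite andNb.
case: e E => [q o|q|q o].
- case: q o => [] [|v] //=.
  + by case: wx same => // l _ [<- _ _]; case: (enum _).
  + by case: rx same => // same [/esym/same].
- case: q => /=.
  + case E: (wprim _ _ _) => [[w' b']|//] [<- _ _].
    case: wx E {same} => //= [v l j s f|v l|v l|v l|v l g|v l|v l|o v [|j s]] // [<- _] //.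
    * by case: s; case: (_ || _).
    * by case: ifP.
    * by case: ifP.
    * by split=> //=; case: ifP.
    * rewrite inE /=; case: (o < v) => //=; case: (o \in s); rewrite ?orbT ?orbF //=; by case: eqP.
  + case E: (rprim _ _ _) => [[r' b']|//] [/esym/same H _ _]; exact: H.
- case: q o => [] [v|] //=.
  + case: wx {same} => // o v [|//] [<- _ _]; split=> //=; rewrite ?in_nil ?andbF //.
  + by case: rx same => // v' same; case: eqP => // _ [/esym/same].
  + by case: rx same => // v' same; case: eqP => // _ [/esym/same].
Qed.

End LinearizationOfWF.

(** * Placement of the linearization points along an execution *)

Section AbstractTrace.

Context (K : nat) (v0 : 'I_K).

Local Notation event := (@event (register v0) role).
Local Notation astate := (astate K).
Local Notation seq_op := (@seq_op (register v0) role).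
Local Notation SeqOp := (@SeqOp (register v0) role).
Local Notation Invocation := (@Invoke (register v0) role).
Local Notation Response := (@Respond (register v0) role).

Context (a : trace (event * config (WF v0))).

Definition ev (n : nat) : option event := omap fst (tr_nth a n).

(** The default of [odflt] is never taken along an execution, by [st_step]. *)
Fixpoint st (n : nat) : astate :=
  if n is m.+1 then
    if ev m is Some e then odflt (st m) (astep (st m) e) else st m
  else astart v0.

(* Identifies the pending operation of [p]; 0 if [p] has invoked nothing. *)
Fixpoint cur (p : role) (n : nat) : nat :=
  if n is m.+1 then
    if ev m is Some (Invoke q _) then if q == p then m else cur p m
    else cur p m
  else 0.

Lemma cur_le p n : cur p n <= n.
Proof.
elim: n => //= n IH; case: (ev n) => [[q o|q|q o]|] //=; try exact: leqW.
by case: ifP => _; [|exact: leqW].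
Qed.

Lemma cur_mono p n m : n <= m -> cur p n <= cur p m.
Proof.
move=> /subnKC <-; elim: (m - n) => [|d IH]; first by rewrite addn0.
apply: leq_trans IH _; rewrite addnS /=.
case: (ev (n + d)) => [[q o|q|q o]|] //=; case: ifP => // _; exact: cur_le.
Qed.

Lemma cur_invoke p n m o : ev n = Some (Invoke p o) -> n < m -> n <= cur p m.
Proof.
by move=> E nm; apply: leq_trans (cur_mono p nm); rewrite /= E eqxx.
Qed.

Context (ex : execution a).

Lemma st_represents n : represents (config_at a n) (st n) /\ wf_inv (st n).
Proof.
elim: n => [|n [R i]].
  rewrite /config_at; split; last exact: inv_start.
  suff -> : last_config (tr_take 0 a) = config0 (WF v0) by exact: represents0.
  by case: (a) => // -[].
rewrite /= /ev; case E: (tr_nth a n) => [[e c]|] /=; last by rewrite config_at_stop.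
have [ok _ _ _ _] := i.
have := simulation (ex E) R ok => -[x' Ex' R']; rewrite Ex' (config_atS E).
by split=> //; exact: inv_step Ex' i.
Qed.

Lemma st_step n e : ev n = Some e -> astep (st n) e = Some (st n.+1).
Proof.
rewrite /= /ev; case E: (tr_nth a n) => [[e' c]|] //= [<-].
have [R [ok _ _ _ _]] := st_represents n.
by have [x' -> _] := simulation (ex E) R ok.
Qed.

Lemma st_stop n : ev n = None -> st n.+1 = st n.
Proof. by move=> /= ->. Qed.

Lemma busyS p n : busy_in p (st n.+1) = match ev n with
    | Some (Invoke q _) => (q == p) || busy_in p (st n)
    | Some (Respond q _) => (q != p) && busy_in p (st n)
    | _ => busy_in p (st n)
    end.
Proof.
case E: (ev n) => [e|]; last by rewrite st_stop.
by rewrite (astep_busy p (st_step E)); case: e {E}.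
Qed.

Lemma invoke_idle p n o : ev n = Some (Invoke p o) -> ~~ busy_in p (st n).
Proof. by move/st_step/astep_enabled => []. Qed.

Lemma respond_busy p n r : ev n = Some (Respond p r) -> busy_in p (st n).
Proof. by move/st_step/astep_enabled => []. Qed.

Lemma busy_cur p n : busy_in p (st n) ->
  cur p n < n /\ ev (cur p n) = Some (Invocation p (op_in p (st n))).
Proof.
elim: n => [|n IH]; first by case: p.
have same e : ev n = Some e -> busy_in p (st n) -> busy_in p (st n.+1) ->
    op_in p (st n.+1) = op_in p (st n).
  by case: p {IH} => // /st_step/astep_value [_ _ H] b1 b2; rewrite /op_in H.
have step' : busy_in p (st n) -> op_in p (st n.+1) = op_in p (st n) ->
    cur p n < n.+1 /\ ev (cur p n) = Some (Invocation p (op_in p (st n.+1))).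
  by move=> /IH[lt E] ->; split=> //; exact: ltnW.
move=> /[dup] b; rewrite busyS [cur p n.+1]/=.
case E: (ev n) => [[q o|q|q o]|].
- case: eqP => [qp _|_ bn]; last exact: step' bn (same _ E bn b).
  subst q; split=> //; rewrite E.
  by have [_ ->] := astep_enabled (st_step E).
- by move=> bn; exact: step' bn (same _ E bn b).
- by case/andP=> _ bn; exact: step' bn (same _ E bn b).
- by move=> bn; apply: step' => //; rewrite st_stop.
Qed.

Lemma returns_busy n m r : returns a n m r -> exists p o,
  [/\ ev n = Some (Invoke p o), ev m = Some (Respond p r), n < m
    & forall k, n < k <= m -> cur p k = n /\ busy_in p (st k)].
Proof.
case=> p [o [En nm Em no]]; exists p, o; split=> //.
elim=> // k IH /andP[]; rewrite ltnS leq_eqVlt => /orP[/eqP<- _|nk km].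
  by rewrite busyS [cur p _]/= [ev n]En eqxx.
have [ck bk] := IH (introT andP (conj nk (ltnW km))).
rewrite busyS [cur p k.+1]/=; case E: (ev k) => [[q o'|q|q r']|] //=.
  by case: eqP E => // -> /invoke_idle; rewrite bk.
split=> //; rewrite bk andbT; apply/eqP => qp; subst q.
by apply: (no k r' _ E); rewrite nk.
Qed.

(** The source of uniqueness: what only an invocation by [p] can undo lasts as long as [cur p] does
    not change. It is applied to a write being effective and to a process being idle. *)
Lemma cur_persist p (D : astate -> bool) i k :
  (forall n e, ev n = Some e -> D (st n) ->
     D (st n.+1) \/ exists o, e = Invoke p o) ->
  cur p i < i -> D (st i.+1) -> i < k -> cur p k = cur p i -> D (st k).
Proof.
move=> HD ci Di; elim: k => // k IH; rewrite ltnS leq_eqVlt => /orP[/eqP<- //|ik] ck.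
have le : cur p k <= cur p k.+1 by exact: cur_mono.
have ge : cur p i <= cur p k by apply: cur_mono; exact: ltnW.
have ck' : cur p k = cur p i by apply/eqP; rewrite eqn_leq ge -ck le.
have Dk := IH ik ck'.
case E: (ev k) => [e|]; last by rewrite st_stop.
have [//|[o eo]] := HD k e E Dk; move: ck; rewrite /= E eo eqxx => kc.
by have := ltn_trans ci ik; rewrite -kc ltnn.
Qed.

Definition flip (i : nat) : bool :=
  ~~ effective (st i) && effective (st i.+1).

Lemma idle_effective n : ~~ busy_in Writer (st n) -> effective (st n).
Proof. by rewrite /effective /=; case: (wp _). Qed.

Lemma flip_cur i : flip i -> cur Writer i < i /\
  ev (cur Writer i) = Some (Invocation Writer (Write (argument (wp (st i))))).
Proof.
case/andP=> ne _; apply: (@busy_cur Writer).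
by apply/negPn/negP => /idle_effective; rewrite (negPf ne).
Qed.

Lemma flip_unique i j : flip i -> flip j -> cur Writer i = cur Writer j -> i = j.
Proof.
suff lt i' j' : flip i' -> flip j' -> cur Writer i' = cur Writer j' -> ~ (i' < j').
  by move=> fi fj c; case: (ltngtP i j) => // [/lt|/lt] []; rewrite ?c.
move=> /[dup] /flip_cur[ci _] /andP[_ ei] /andP[nj _] c ij.
move/negP: nj; apply; apply: (cur_persist _ ci ei ij (esym c)) => n e E en.
have [_ + _] := astep_value (st_step E).
case: e {E} => [[] o|q|q o]; by [right; exists o|left; auto].
Qed.

Lemma respond_unique p m m' r r' : ev m = Some (Respond p r) ->
  ev m' = Some (Respond p r') -> cur p m = cur p m' -> m = m'.
Proof.
suff lt i j s s' : ev i = Some (Respond p s) -> ev j = Some (Respond p s') ->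
    cur p i = cur p j -> ~ (i < j).
  by move=> fi fj c; case: (ltngtP m m') => //
    [/(lt _ _ _ _ fi fj)|/(lt _ _ _ _ fj fi)] []; rewrite ?c.
move=> Ei /respond_busy bj c ij.
have [ci _] := busy_cur (respond_busy Ei).
suff : ~~ busy_in p (st j) by rewrite bj.
apply: (@cur_persist p (fun x => ~~ busy_in p x) i _ _ ci _ ij (esym c)); last first.
  by rewrite busyS Ei eqxx.
move=> n e E bn.
  rewrite busyS E; case: e {E} => [q o|q|q o]; [|by left|].
    by case: eqP => [->|_]; [right; exists o|left].
by left; rewrite (negPf bn) andbF.
Qed.

(** Converts membership in the ghost list into a time within the current read, the first such time
    being just after the invocation. *)
Lemma seen_value n y : busy_in Reader (st n) -> y \in seen (st n) ->
  exists2 t, cur Reader n < t <= n & value (wp (st t)) = y.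
Proof.
elim: n => // n IH; rewrite busyS [cur _ _]/=; case E: (ev n) => [e|]; last first.
  by rewrite st_stop // => b /(IH b)[t /andP[h1 h2] h3]; exists t; rewrite ?h1 ?(leqW h2).
have ext : busy_in Reader (st n) -> y \in value (wp (st n.+1)) :: seen (st n) ->
    exists2 t, cur Reader n < t <= n.+1 & value (wp (st t)) = y.
  move=> b; rewrite inE => /orP[/eqP->|/(IH b)[t /andP[h1 h2] h3]].
    by exists n.+1 => //; rewrite ltnS cur_le leqnn.
  by exists t => //; rewrite h1 ltnW.
rewrite (astep_seen (st_step E)); case: e E => [[] o|q|[] o] E //=.
by move=> _; rewrite inE => /eqP->; exists n.+1; rewrite ?ltnSn ?leqnn.
Qed.

(** A write that has taken effect gets a point even if it is pending, a read only if it returns.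
    Taking the first suitable configuration makes the point of a read unique, and parity separates
    reads from writes. *)
Inductive lin_at : nat -> seq_op -> Prop :=
| LinWrite i : flip i ->
    lin_at i.*2.+1
      (SeqOp (cur Writer i) Writer (Write (argument (wp (st i)))) None)
| LinRead m t v : ev m = Some (Response Reader (Some v)) ->
    cur Reader m < t <= m -> value (wp (st t)) = v ->
    (forall t', cur Reader m < t' < t -> value (wp (st t')) <> v) ->
    lin_at t.*2 (SeqOp (cur Reader m) Reader Read (Some v)).

Lemma lin_at_write i x : lin_at i.*2.+1 x -> flip i /\
  x = SeqOp (cur Writer i) Writer (Write (argument (wp (st i)))) None.
Proof.
move E: i.*2.+1 => k L; case: L E => [j fj [/double_inj->] //|m t v _ _ _ _ e].
by have := congr1 odd e; rewrite /= !odd_double.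
Qed.

Lemma lin_at_read t x : lin_at t.*2 x -> exists m v,
  [/\ ev m = Some (Response Reader (Some v)), cur Reader m < t <= m,
    value (wp (st t)) = v,
    (forall t', cur Reader m < t' < t -> value (wp (st t')) <> v)
  & x = SeqOp (cur Reader m) Reader Read (Some v)].
Proof.
move E: t.*2 => k L; case: L E => [j fj e|m t' v Em lt vt mt /double_inj e].
  by have := congr1 odd e; rewrite /= !odd_double.
by subst t'; exists m, v.
Qed.

Lemma read_cur m t r : ev m = Some (Respond Reader r) -> cur Reader m < t <= m ->
  cur Reader t = cur Reader m.
Proof.
move=> /respond_busy/busy_cur[_ E] /andP[lt tm]; apply/eqP.
by rewrite eqn_leq cur_mono //= (cur_invoke E lt).
Qed.

(** At most one read is in progress at a configuration, and at most one event occurs at a step. *)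
Lemma lin_at_fun k x y : lin_at k x -> lin_at k y -> x = y.
Proof.
case=> [i fi /lin_at_write[_ ->] //|m t v Em lt vt _ /lin_at_read[m' [v' [Em' lt' vt' _ ->]]]].
have c : cur Reader m = cur Reader m'.
  by rewrite -(read_cur Em lt) -(read_cur Em' lt').
by have e := respond_unique Em Em' c; rewrite c -vt vt'.
Qed.

Lemma lin_at_uniq k l x y : lin_at k x -> lin_at l y -> sid x = sid y -> k = l.
Proof.
have neq i m r : flip i -> ev m = Some (Respond Reader r) -> cur Writer i <> cur Reader m.
  by move=> /flip_cur[_ E] /respond_busy/busy_cur[_ E'] c; rewrite c E' in E.
case=> [i fi|m t v Em lt vt mt] [j fj|m' t' v' Em' lt' vt' mt'] /= c.
- by rewrite (flip_unique fi fj c).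
- by case: (neq _ _ _ fi Em').
- by case: (neq _ _ _ fj Em).
- have e := respond_unique Em Em' c; subst m'.
  move: Em'; rewrite Em => -[vv]; rewrite -{}vv in vt' mt'.
  case: (ltngtP t t') => [h|h|-> //].
    have [] := mt' t _ vt; by rewrite h andbT; case/andP: lt.
  have [] := mt t' _ vt'; by rewrite h andbT; case/andP: lt'.
Qed.

Lemma flip_between n m : n <= m -> ~~ effective (st n) -> effective (st m) ->
  exists2 i, n <= i < m & flip i.
Proof.
move=> /subnKC <-; elim: (m - n) => [|d IH]; first by rewrite addn0 => /negPf->.
move=> nn; rewrite addnS => em; case: (boolP (effective (st (n + d)))) => [en|ne].
  by have [i /andP[ni id] fi] := IH nn en; exists i => //; rewrite ni ltnS ltnW.
by exists (n + d); rewrite ?leq_addr ?ltnSn // /flip ne em.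
Qed.

Lemma returns_lin_at n m r : returns a n m r ->
  exists k x, [/\ lin_at k x, sid x = n, sresp x = r & k <= m.*2.+1].
Proof.
move=> /returns_busy[p [o [En Em nm bc]]].
have [bm rm em] := astep_enabled (st_step Em).
have [cm _] := bc m (introT andP (conj nm (leqnn m))).
case: p En Em bc bm rm em cm => En Em bc bm rm em cm.
  (* The write is not effective just after its invocation but is so at its return, hence it flips in
     between. *)
  have ne : ~~ effective (st n.+1) by have [_ + _] := astep_value (st_step En).
  have [i /andP[ni im] fi] := flip_between nm ne (em erefl).
  have [ci _] := bc i (introT andP (conj ni (ltnW im))).
  exists i.*2.+1,
    (SeqOp (cur Writer i) Writer (Write (argument (wp (st i)))) None).
  by split=> //; [exact: LinWrite|rewrite ltnS leq_double ltnW].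
(* The invariant at [RDone] says that the value returned was seen during the read. *)
have [_ [_ _ _ _]] := st_represents m; rewrite rm /= => -[_ [v rv vS]].
have [t0 t0m vt0] := seen_value bm vS.
have ext : exists t, (cur Reader m < t <= m) && (value (wp (st t)) == v).
  by exists t0; rewrite t0m vt0 eqxx.
case: (ex_minnP ext) => t /andP[tm /eqP vt] min.
have tm' : t <= m by case/andP: tm.
exists t.*2,
  (SeqOp (cur Reader m) Reader Read (Some v)); split=> //.
- rewrite rv in Em; apply: LinRead Em tm vt _ => t' /andP[h1 h2] e.
  have t'm : t' <= m by exact: ltnW (leq_trans h2 tm').
  by have := min t'; rewrite h1 t'm e eqxx => /(_ isT); rewrite leqNgt h2.
- by apply: leqW; rewrite leq_double.
Qed.

Lemma lin_at_invoked k x : lin_at k x ->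
  invoked a (sid x) (sproc x) (sop x) /\ (sid x).*2.+1 < k.
Proof.
case=> [i fi|m t v Em lt vt _] /=.
  by have [ci ei] := flip_cur fi; split=> //; rewrite ltnS ltn_double.
have [_ E] := busy_cur (respond_busy Em); split; first exact: E.
by rewrite -doubleS leq_double; case/andP: lt.
Qed.

(** The two prefixes differ at most by a read, which preserves the state. The step at [t] changes
    [value] only if it is a flip, and then to the argument of the write linearized there. *)
Lemma state_points g t : (forall k x, g k = Some x <-> lin_at k x) ->
  state_of (points g t.*2) = value (wp (st t)) /\
  state_of (points g t.*2.+1) = value (wp (st t)).
Proof.
move=> gP; elim: t => [|t [_ IH]].
  have E : state_of (points g 0) = value (wp (st 0)) by [].
  split=> //; rewrite pointsS; case G: (g 0) => [x|//].
  move/gP/(@lin_at_read 0): G => [m [v [_ _ _ _ ->]]].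
  by rewrite /state_of foldl_rcons.
have E : state_of (points g t.+1.*2) = value (wp (st t.+1)).
  rewrite doubleS pointsS; case G: (g _) => [x|].
    move/gP/lin_at_write: G => [fl ->].
    rewrite /state_of foldl_rcons /=.
    case Ee: (ev t) => [e|]; last first.
      by move: fl; rewrite /flip st_stop // andNb.
    have [+ _ _] := astep_value (st_step Ee).
    by rewrite -/(flip t) fl /= Ee /= => ->.
  rewrite IH; case Ee: (ev t) => [e|]; last by rewrite st_stop.
  have [-> _ _] := astep_value (st_step Ee); case: ifP => // fl.
  by have /gP := LinWrite fl; rewrite G.
split=> //; rewrite pointsS; case G: (g _) => [x|//].
move/gP/lin_at_read: G => [m [v [_ _ _ _ ->]]].
by rewrite /state_of foldl_rcons.
Qed.

(** While the reader is idle every set entry of B is tentative, which it cannot be when the writer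
    is idle too. *)
Lemma quiescent_memory n : quiescent (config_at a n) -> forall i : cell K,
  bmem (config_at a n) i = if i is A j then j == value (wp (st n)) else false.
Proof.
move=> q; have [[Rw Rr Rm] [_ _ _ _ ri]] := st_represents n.
have [l El] := q Writer; have [u Eu] := q Reader.
move=> i; rewrite Rm; rewrite El in Rw; rewrite Eu in Rr.
case: (wp (st n)) Rw ri => // l' _; case: (rp (st n)) Rr => //= _ nb.
by case: i => // j; apply/negbTE/negP => /nb.
Qed.

Lemma WF_linearization : exists2 s, linearization a s
  & forall (l : seq (event * config (WF v0))) (s' : seq seq_op),
    a = Fin l -> s = Fin s' -> quiescent (last_config l) -> forall i : cell K,
    bmem (last_config l) i = if i is A j then j == state_of s' else false.
Proof.
have [g gP] := partial_function lin_at_fun.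
have [||||||s sl sf] := @linearization_of_points _ _ _ _ _ _ a g.
- by move=> k x /gP/lin_at_invoked[].
- by move=> k l x y /gP Lk /gP; exact: lin_at_uniq Lk.
- by move=> n m r /returns_lin_at[k [x [/gP L xn xr _]]]; exists k, x.
- by move=> k x /gP/lin_at_invoked[].
- move=> k x j r /gP L /returns_lin_at[l [y [Ly ys _ lj]]].
  by rewrite (lin_at_uniq L Ly (esym ys)).
- move=> k x /gP; case=> [i fi //|m t v Em lt vt _] /=.
  by have [-> _] := state_points t gP; rewrite vt.
exists s => // l s' al ss' q i.
have sz n : size l <= n -> config_at a n = last_config l.
  by move=> ln; rewrite /config_at al /= take_oversize.
(* [M] lies beyond both the end of the execution and the last point. *)
have [N NP] := sf s' ss'; pose M := maxn N (size l).
rewrite (NP M.*2); last by rewrite -addnn (leq_trans (leq_maxl _ _) (leq_addr _ _)).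
have [-> _] := state_points M gP.
by rewrite -(sz M) ?leq_maxr // in q *; exact: quiescent_memory.
Qed.

End AbstractTrace.

Theorem theorem12 (K : nat) (v0 : 'I_K) (hK : 3 <= K) :
  let W : @implementation (register v0) role swsr (cell K) (cells v0) := WF v0 in
  [/\ linearizable W, wait_free W & quiescent_HI W].
Proof.
split; [|exact: WF_wait_free|].
  by move=> a /WF_linearization[s sl _]; exists s.
(* In a good linearization the final state determines the memory of a quiescent configuration;
   choosing one for each execution gives the function required, with an arbitrary value on traces
   that are not executions. *)
pose good a s := linearization a s
  /\ forall (l : seq (@event (register v0) role * config (WF v0))) s',
    a = Fin l -> s = Fin s' -> quiescent (last_config l) -> forall i : cell K,
    bmem (last_config l) i = if i is A j then j == state_of s' else false.
have exh a : exists s, execution a -> good a s.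
  case: (classic (execution a)) => [/WF_linearization[s sl sf]|no].
    by exists s => _; split.
  by exists (Fin [::]) => /no.
pose h a := proj1_sig (constructive_indefinite_description _ (exh a)).
have hP a : execution a -> good a (h a).
  by rewrite /h; case: constructive_indefinite_description.
exists h => [a /hP[]//|a a' s s' /hP[_ H] /hP[_ H'] qa qa' ha ha' e i].
by rewrite (H _ _ erefl ha qa) (H' _ _ erefl ha' qa') e.
Qed.
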